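(* Let $k$ be a field, $R=k[x_0,\ldots,x_d]$, $\mathfrak m=(x_0,\ldots,x_d)$, let $n\ge d$, and let $\mathcal F:\mathbb{P}^d_k=\mathrm{Proj}(R)\dashrightarrow\mathbb{P}^n_k$ be a rational map defined by $n+1$ homogeneous elements $f_0,\ldots,f_n\in R$ of the same degree $\delta>0$. Let $I=(f_0,\ldots,f_n)\subset R$. If $\mathcal F$ is a generically finite map, then $$d_0(\mathcal F)=e\big(\widetilde{\mathfrak F}(I)\big),$$ where $d_0(\mathcal F)$ is the $0$-th projective degree of $\mathcal F$ and $\widetilde{\mathfrak F}(I)$ is the saturated special fiber ring of $I$.
   Context: Saturated special fiber ring: $\widetilde{\mathfrak F}(I)=\bigoplus_{q=0}^\infty\big[(I^q:\mathfrak m^\infty)\big]_{q\delta}$, a graded $k$-algebra. Let $S=k[f_0,\ldots,f_n]=\bigoplus_{q=0}^\infty[I^q]_{q\delta}$, regarded as a standard graded $k$-algebra (with $f_j$ of degree $1$); it is the homogeneous coordinate ring of the closure $Y\subseteq\mathbb{P}^n_k$ of the image of $\mathcal F$. $\widetilde{\mathfrak F}(I)$ is a finitely generated graded $S$-module, and $e(\widetilde{\mathfrak F}(I))$ denotes its multiplicity as such (if $s$ is its Krull dimension, $e$ is $(s-1)!$ times the leading coefficient of the polynomial, of degree $s-1$, giving $\dim_k[\widetilde{\mathfrak F}(I)]_q$ for $q\gg0$). Generically finite means that $\mathcal F:\mathbb{P}^d_k\dashrightarrow Y$ is generically finite, equivalently $\dim Y=d$. Projective degrees: let $\mathfrak A=R[y_0,\ldots,y_n]$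 be bigraded by $\mathrm{bideg}(x_i)=(1,0)$, $\mathrm{bideg}(y_j)=(0,1)$. The Rees algebra $\mathcal R(I)=\bigoplus_{q\ge0}I^qt^q\subset R[t]$ is a bigraded quotient of $\mathfrak A$ via $y_j\mapsto f_jt$, and $\Gamma=\mathrm{BiProj}(\mathcal R(I))\subset\mathbb{P}^d_k\times_k\mathbb{P}^n_k$ is the closure of the graph of $\mathcal F$. For $0\le i\le d$, $d_i(\mathcal F)$ is the multidegree of $\Gamma$ of type $(i,d-i)$, i.e. $d_i(\mathcal F)=e(i,d-i;\mathcal R(I))$, where: the function $(u,v)\mapsto\dim_k[\mathcal R(I)]_{(u,v)}$ agrees for $u,v\gg0$ with a polynomial $P_{\mathcal R(I)}(u,v)$ of total degree $d=\dim\Gamma$, and the coefficient of $u^iv^{d-i}$ in $P_{\mathcal R(I)}$ is $e(i,d-i;\mathcal R(I))/(i!(d-i)!)$. *)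

(* Defs.v *)
From HB Require Import structures.
From mathcomp Require Import all_boot all_order all_algebra.
From mathcomp Require Import polyXY mpoly.

Set Implicit Arguments.
Unset Strict Implicit.
Unset Printing Implicit Defensive.

Import GRing.Theory.
Local Open Scope ring_scope.

Definition has_dim (k : fieldType) (V : lmodType k) (W : V -> Prop) (h : nat)
    : Prop :=
  exists b : 'I_h -> V,
    (forall v, W v <-> exists c : 'rV[k]_h, v = \sum_i c 0 i *: b i) /\
    (forall c : 'rV[k]_h, \sum_i c 0 i *: b i = 0 -> c = 0).

(* Ideals are Prop-valued predicates, since membership is not decidable over an
   abstract field. *)
Section Ideals.
Variable A : comNzRingType.
Implicit Types (G I J : A -> Prop).

Definition ideal_gen G : A -> Prop := fun p =>
  exists s : seq (A * A),
    (forall x, x \in s -> G x.2) /\ p = \sum_(x <- s) x.1 * x.2.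

Definition ideal_mul I J : A -> Prop :=
  ideal_gen (fun p => exists a b, [/\ I a, J b & p = a * b]).

Fixpoint ideal_exp I (q : nat) : A -> Prop :=
  if q is q'.+1 then ideal_mul I (ideal_exp I q') else fun=> True.

(* (I : J^oo) *)
Definition ideal_sat I J : A -> Prop := fun p =>
  exists N : nat, forall a, ideal_exp J N a -> I (a * p).

End Ideals.

Section RationalMap.
Variables (k : fieldType) (d n : nat).
Local Notation R := {mpoly k[d.+1]}.
Implicit Types (f : n.+1.-tuple R) (delta : nat).

Definition irrelevant_ideal : R -> Prop :=
  ideal_gen (fun p => exists i : 'I_d.+1, p = 'X_i).

Definition base_ideal f : R -> Prop :=
  ideal_gen (fun p => exists j : 'I_n.+1, p = tnth f j).

Definition graded_piece (I : R -> Prop) (w : nat) : R -> Prop :=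
  fun p => I p /\ p \is w.-homog.

(* The forms of degree q in S = k[f_0, ..., f_n], each f_j having degree 1. *)
Definition image_coord_ring f (q : nat) : R -> Prop := fun a =>
  exists2 g : {mpoly k[n.+1]}, g \is q.-homog & a = g \mPo f.

(* For A_w the degree w part of a graded subring of R, this is the function
   field of Proj of that subring, as a subfield of Frac(R). *)
Definition degree0_fractions (A_ : nat -> R -> Prop) : {fraction R} -> Prop :=
  fun z => exists (w : nat) (a b : R),
    [/\ A_ w a, A_ w b, b != 0 & z = tofrac a / tofrac b].

Definition function_field_source : {fraction R} -> Prop :=
  degree0_fractions (graded_piece (fun=> True)).

Definition function_field_image f : {fraction R} -> Prop :=
  degree0_fractions (image_coord_ring f).

(* K(P^d) is a finite extension of K(Y), Y being the closure of the image. *)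
Definition generically_finite f : Prop :=
  exists (r : nat) (b : 'I_r -> {fraction R}),
    (forall i, function_field_source (b i)) /\
    (forall z, function_field_source z ->
       exists c : 'I_r -> {fraction R},
         (forall i, function_field_image f (c i)) /\ z = \sum_i c i * b i).

(* [R(I)]_(u,v) = [I^v]_(u + v delta) t^v, because bideg x_i = (1,0) and
   bideg (f_j t) = (0,1) force bideg t = (- delta, 1); the factor t^v is
   dropped. *)
Definition rees_piece f delta (u v : nat) : R -> Prop :=
  graded_piece (ideal_exp (base_ideal f) v) (u + v * delta).

Definition sat_fiber_piece f delta (q : nat) : R -> Prop :=
  graded_piece (ideal_sat (ideal_exp (base_ideal f) q) irrelevant_ideal)
    (q * delta).

(* In {poly {poly rat}}, P.[u, v] substitutes u for the outer variable and v for
   the inner one, so P`_i`_j is the coefficient of u^i v^j. *)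
Definition hilbert_poly2 (M : nat -> nat -> R -> Prop) (P : {poly {poly rat}})
    : Prop :=
  exists N : nat, forall u v : nat, (N <= u)%N -> (N <= v)%N ->
    exists2 h : nat, has_dim (M u v) h & P.[u%:R, v%:R] = h%:R.

Definition hilbert_poly1 (M : nat -> R -> Prop) (P : {poly rat}) : Prop :=
  exists N : nat, forall q : nat, (N <= q)%N ->
    exists2 h : nat, has_dim (M q) h & P.[q%:R] = h%:R.

Definition is_projective_degree f delta (i : nat) (e : rat) : Prop :=
  exists2 P : {poly {poly rat}}, hilbert_poly2 (rees_piece f delta) P &
    e = (i`! * (d - i)`!)%:R * P`_i`_(d - i).

(* The degree of the Hilbert polynomial P is (size P).-1, which is s - 1 for s
   the Krull dimension of the module. *)
Definition is_multiplicity (M : nat -> R -> Prop) (e : rat) : Prop :=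
  exists2 P : {poly rat}, hilbert_poly1 M P &
    e = ((size P).-1)`!%:R * lead_coef P.

End RationalMap.

(* Main.v *)
(** Let Q_(u,v) = [I^v]_(u + v delta) be the bigraded pieces of the Rees algebra,
    spanned by the x^a f^b with |a| = u and |b| = v, and let A_v be the pieces of
    the saturated special fiber ring.

    Call a monomial x^a f^b leading for a bigraded submodule W of Q if it lies in
    W modulo the span of smaller monomials of the same bidegree.  The leading
    monomials are closed under multiplication and dim W_(u,v) is a difference of
    two counts of leading monomials, so Dickson's lemma and inclusion-exclusion
    make it polynomial.  The same bookkeeping shows that the saturation of I^v
    agrees with I^v in x-degree u >= u1 with u1 independent of v; hence
    x_0^(u1) A_v embeds in Q_(u1,v) and A has a Hilbert polynomial too.

    Since dim Q_(u,v) <= dim R_(u + v delta), the coefficient L of v^d in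
    P(u, v) does not depend on u, that is, L = d_0 / d!.  Generic finiteness
    gives, by clearing denominators in the multiplication table of K(P^d) over
    K(Y), that dim S_v is not bounded by a polynomial of degree < d.  This
    makes L positive, and by Kodaira's argument it produces a nonzero g of degree
    c delta - t in the saturation of I^c with t large.  Then
    g Q_(t,v) <= A_(c+v) and x_0^(u1) A_v <= Q_(u1,v), so A_v grows like L v^d. *)
Require Import Defs.
From HB Require Import structures.
From mathcomp Require Import all_boot all_order all_algebra.
From mathcomp Require Import boolp.
From mathcomp Require Import polyXY mpoly.
From mathcomp Require Import zify lra.

Set Implicit Arguments.
Unset Strict Implicit.
Unset Printing Implicit Defensive.

Import Order.TTheory GRing.Theory Num.Theory.
Local Open Scope ring_scope.

(** * Linear algebra over Prop-valued subspaces *)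

Section LinearSpans.
Variable k : fieldType.
Implicit Types V : lmodType k.

Definition subspace V (W : V -> Prop) : Prop :=
  W 0 /\ forall a x y, W x -> W y -> W (a *: x + y).

(** Built one term at a time, so that properties of a span are proved by induction without choosing
    a finite family. *)
Inductive lspan V (G : V -> Prop) : V -> Prop :=
| lspan0 : lspan G 0
| lspan_cons a g x of G g & lspan G x : lspan G (a *: g + x).

Lemma subspaceZ V (W : V -> Prop) a x : subspace W -> W x -> W (a *: x).
Proof. by move=> [W0 WD] Wx; rewrite -[_ *: _]addr0; apply: WD. Qed.

Lemma subspaceD V (W : V -> Prop) x y : subspace W -> W x -> W y -> W (x + y).
Proof. by move=> [_ WD] Wx Wy; rewrite -[x]scale1r; apply: WD. Qed.

Lemma subspaceN V (W : V -> Prop) x : subspace W -> W x -> W (- x).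
Proof. by move=> sW Wx; rewrite -scaleN1r; apply: subspaceZ. Qed.

Lemma subspaceB V (W : V -> Prop) x y : subspace W -> W x -> W y -> W (x - y).
Proof. by move=> sW Wx Wy; apply: subspaceD => //; apply: subspaceN. Qed.

Lemma subspace_sum V (W : V -> Prop) (I : Type) (r : seq I) (P : pred I) F :
  subspace W -> (forall i, P i -> W (F i)) -> W (\sum_(i <- r | P i) F i).
Proof.
move=> sW WF; elim/big_ind: _ => //; first by case: sW.
by move=> x y; apply: subspaceD.
Qed.

Lemma subspace_sum_seq V (W : V -> Prop) (I : eqType) (r : seq I) F :
  subspace W -> (forall i, i \in r -> W (F i)) -> W (\sum_(i <- r) F i).
Proof. by move=> sW WF; rewrite big_seq; apply: subspace_sum. Qed.

Lemma subspace_eq0 V : subspace (eq^~ (0 : V)).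
Proof. by split=> // a x y -> ->; rewrite scaler0 addr0. Qed.

Lemma lspan_subspace V (G : V -> Prop) : subspace (lspan G).
Proof.
split; first exact: lspan0.
move=> a x y; elim=> [|b g {}x Gg _ IH] Gy; first by rewrite scaler0 add0r.
by rewrite scalerDr -addrA scalerA; apply: lspan_cons => //; apply: IH.
Qed.

Lemma lspan_in V (G : V -> Prop) x : G x -> lspan G x.
Proof.
by move=> Gx; rewrite -[x]scale1r -[_ *: x]addr0; apply: lspan_cons => //;
  apply: lspan0.
Qed.

Lemma linear_for0 V V' (phi : V -> V') : linear phi -> phi 0 = 0.
Proof.
by move=> lin; have := lin (-1) 0 0; rewrite scaler0 addr0 scaleN1r addNr.
Qed.

Lemma lspan_linear V V' (phi : V -> V') (G : V -> Prop) (W : V' -> Prop) :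
    linear phi -> subspace W -> (forall g, G g -> W (phi g)) ->
  forall x, lspan G x -> W (phi x).
Proof.
move=> lin sW GW x; elim=> [|a g {}x Gg _ IH].
  by rewrite linear_for0 //; case: sW.
by rewrite lin; case: sW => _; apply=> //; apply: GW.
Qed.

Lemma lspan_sub V (G W : V -> Prop) :
  subspace W -> (forall g, G g -> W g) -> forall x, lspan G x -> W x.
Proof. by move=> sW GW x; apply: (@lspan_linear _ _ id). Qed.

Lemma lspan_mono V (G G' : V -> Prop) :
  (forall g, G g -> G' g) -> forall x, lspan G x -> lspan G' x.
Proof.
move=> GG'; apply: lspan_sub; first exact: lspan_subspace.
by move=> g /GG'; apply: lspan_in.
Qed.

Lemma lspan_seqP V (e : seq V) x :
  lspan (fun y => y \in e) x <-> exists c : 'I_(size e) -> k,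
    x = \sum_i c i *: e`_i.
Proof.
split=> [|[c ->]]; last first.
  apply: subspace_sum; first exact: lspan_subspace.
  move=> i _; apply: subspaceZ; first exact: lspan_subspace.
  by apply: lspan_in; apply: mem_nth.
elim=> [|a g {}x ge _ [c ->]].
  by exists (fun=> 0); rewrite big1 // => i _; rewrite scale0r.
have lt_g : (index g e < size e)%N by rewrite index_mem.
exists (fun i => (if i == Ordinal lt_g then a else 0) + c i).
under [RHS]eq_bigr => i _ do rewrite scalerDl.
rewrite big_split /=; congr (_ + _).
rewrite (bigD1 (Ordinal lt_g)) //= eqxx nth_index // big1 ?addr0 // => i.
by move/negbTE->; rewrite scale0r.
Qed.

(** The matrix of coordinates of the [b i] along [e] has trivial left kernel, so its rank is [h],
    which is at most the number of columns. *)
Lemma indep_le_size V h (b : 'I_h -> V) (e : seq V) :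
    (forall c : 'rV[k]_h, \sum_i c 0 i *: b i = 0 -> c = 0) ->
    (forall i, lspan (fun y => y \in e) (b i)) ->
  (h <= size e)%N.
Proof.
move=> indep spb.
have /choice[C bE] i : exists c : 'I_(size e) -> k, b i = \sum_j c j *: e`_j.
  by apply/lspan_seqP.
pose A : 'M[k]_(h, size e) := \matrix_(i, j) C i j.
suff : row_free A by rewrite /row_free => /eqP <-; apply: rank_leq_col.
rewrite -kermx_eq0.
apply/eqP/row_matrixP => r; rewrite row0; apply: indep.
under eq_bigr => i _ do rewrite bE scaler_sumr.
rewrite exchange_big /= big1 // => j _.
under eq_bigr => i _ do rewrite scalerA.
rewrite -scaler_suml.
suff -> : \sum_i row r (kermx A) 0 i * C i j = 0 by rewrite scale0r.
have := congr1 (fun M : 'M__ => M r j) (mulmx_ker A).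
rewrite mxE [RHS]mxE; apply: etrans; apply: eq_bigr => i _.
by rewrite [row _ _ _ _]mxE [A _ _]mxE.
Qed.

End LinearSpans.

Section Dimension.
Variable k : fieldType.
Implicit Types V : lmodType k.

Lemma has_dim_subspace V (W : V -> Prop) h : has_dim W h -> subspace W.
Proof.
move=> [b [Wb _]]; split.
  by apply/Wb; exists 0; rewrite big1 // => i _; rewrite mxE scale0r.
move=> a x y /Wb[c ->] /Wb[c' ->]; apply/Wb; exists (a *: c + c').
rewrite scaler_sumr -big_split /=; apply: eq_bigr => i _.
by rewrite !mxE scalerDl scalerA.
Qed.

Lemma has_dim_basis_in V (W : V -> Prop) h (b : 'I_h -> V) :
    (forall v, W v <-> exists c : 'rV[k]_h, v = \sum_i c 0 i *: b i) ->
  forall i, W (b i).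
Proof.
move=> Wb i; apply/Wb; exists (delta_mx 0 i).
rewrite (bigD1 i) //= mxE !eqxx scale1r big1 ?addr0 // => j /negbTE ji.
by rewrite mxE ji andbF scale0r.
Qed.

Lemma has_dim_ext V (W W' : V -> Prop) h :
  (forall x, W x <-> W' x) -> has_dim W h -> has_dim W' h.
Proof.
move=> WW' [b [Wb ib]]; exists b; split=> // v.
by rewrite -WW'.
Qed.

Lemma has_dim0 V (W : V -> Prop) : (forall x, W x <-> x = 0) -> has_dim W 0.
Proof.
move=> W0; exists (fun=> 0); split=> [v|c _]; last by apply/rowP=> -[].
by rewrite W0; split=> [->|[c ->]]; [exists 0|]; rewrite big_ord0.
Qed.

Lemma has_dim_seq V (W : V -> Prop) h : has_dim W h ->
  exists2 e : seq V, size e = h & forall x, W x <-> lspan (fun y => y \in e) x.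
Proof.
move=> dW; have sW := has_dim_subspace dW; case: dW => b [Wb _].
exists (codom b); first by rewrite size_codom card_ord.
move=> x; split=> [/Wb[c ->]|].
  apply: subspace_sum; first exact: lspan_subspace.
  move=> i _; apply: subspaceZ; first exact: lspan_subspace.
  by apply: lspan_in; apply: codom_f.
apply: lspan_sub => // _ /codomP[i ->].
exact: (has_dim_basis_in Wb).
Qed.

Lemma indep_inj V V' (phi : V -> V') (W : V -> Prop) h (b : 'I_h -> V) :
    linear phi -> (forall x, W x -> phi x = 0 -> x = 0) ->
    (forall v, W v <-> exists c : 'rV[k]_h, v = \sum_i c 0 i *: b i) ->
    (forall c : 'rV[k]_h, \sum_i c 0 i *: b i = 0 -> c = 0) ->
  forall c : 'rV[k]_h, \sum_i c 0 i *: phi (b i) = 0 -> c = 0.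
Proof.
move=> lin inj Wb ib c; pose L := GRing.isLinear.Build _ _ _ _ phi lin.
pose f : {linear V -> V'} := HB.pack phi L.
rewrite (eq_bigr (fun i => f (c 0 i *: b i))); last first.
  by move=> i _; rewrite linearZ.
by rewrite -linear_sum => /inj z; apply: ib; apply: z; apply/Wb; exists c.
Qed.

Lemma has_dim_inj_le_size V V' (phi : V -> V') (W : V -> Prop) h (e : seq V') :
    linear phi -> (forall x, W x -> phi x = 0 -> x = 0) ->
    has_dim W h -> (forall x, W x -> lspan (fun y => y \in e) (phi x)) ->
  (h <= size e)%N.
Proof.
move=> lin inj [b [Wb ib]] We; apply: (@indep_le_size _ _ _ (phi \o b)).
  exact: (indep_inj lin inj Wb ib).
by move=> i; apply: We; apply: (has_dim_basis_in Wb).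
Qed.

Lemma has_dim_inj_le V V' (phi : V -> V') (W : V -> Prop) (W' : V' -> Prop)
    h h' :
    linear phi -> (forall x, W x -> phi x = 0 -> x = 0) ->
    has_dim W h -> has_dim W' h' -> (forall x, W x -> W' (phi x)) ->
  (h <= h')%N.
Proof.
move=> lin inj dW /has_dim_seq[e <- W'e] WW'.
by apply: (has_dim_inj_le_size lin inj dW) => x /WW'/W'e.
Qed.

Lemma has_dim_inj V V' (phi : V -> V') (W : V -> Prop) (W' : V' -> Prop) h :
    linear phi -> (forall x, W x -> phi x = 0 -> x = 0) ->
    (forall y, W' y <-> exists2 x, W x & y = phi x) ->
  has_dim W h -> has_dim W' h.
Proof.
move=> lin inj WW' [b [Wb ib]]; exists (phi \o b); split; last first.
  exact: (indep_inj lin inj Wb ib).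
pose f : {linear V -> V'} := HB.pack phi (GRing.isLinear.Build _ _ _ _ phi lin).
have fE (c : 'rV_h) : phi (\sum_i c 0 i *: b i) = \sum_i c 0 i *: phi (b i).
  rewrite -[phi]/(f : V -> V') linear_sum.
  by apply: eq_bigr => i _; rewrite linearZ.
move=> y; rewrite WW'; split=> [[x /Wb[c ->] ->]|[c ->]].
  by exists c; rewrite fE.
by exists (\sum_i c 0 i *: b i); [apply/Wb; exists c | rewrite fE].
Qed.

Lemma has_dimS V (W W' : V -> Prop) h w :
    has_dim W h -> ~ W w ->
    (forall x, W' x <-> exists c, W (x - c *: w)) ->
  has_dim W' h.+1.
Proof.
move=> dW Ww WW'; have sW := has_dim_subspace dW; case: dW => b [Wb ib].
pose b' (i : 'I_h.+1) := if unlift ord0 i is Some j then b j else w.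
have b'0 : b' ord0 = w by rewrite /b' unlift_none.
have b'S j : b' (lift ord0 j) = b j by rewrite /b' liftK.
have sumb' (c : 'rV_h.+1) : \sum_i c 0 i *: b' i =
    c 0 ord0 *: w + \sum_i (\row_j c 0 (lift ord0 j)) 0 i *: b i.
  rewrite big_ord_recl b'0; congr (_ + _).
  by apply: eq_bigr => i _; rewrite b'S mxE.
exists b'; split=> [x|c].
  rewrite WW'; split=> [[a /Wb[c xE]]|[c ->]]; last first.
    exists (c 0 ord0); apply/Wb.
    by exists (\row_j c 0 (lift ord0 j)); rewrite sumb' addrC addKr.
  exists (\row_i if unlift ord0 i is Some j then c 0 j else a).
  rewrite sumb' mxE unlift_none -[LHS](subrK (a *: w)) addrC xE; congr (_ + _).
  by apply: eq_bigr => i _; rewrite !mxE liftK.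
rewrite sumb'; set y := \sum_i _; have Wy : W y by apply/Wb; eexists.
have [c0 | c0] := eqVneq (c 0 ord0) 0; last first.
  move=> /eqP; rewrite addr_eq0 => /eqP wE; case: Ww.
  rewrite -[w]scale1r -(mulVf c0) -scalerA wE.
  by apply: subspaceZ => //; apply: subspaceN.
rewrite c0 scale0r add0r => /ib/rowP r0.
apply/rowP=> i; rewrite [RHS]mxE.
case: (unliftP ord0 i) => [j ->|->].
  by have := r0 j; rewrite !mxE.
by [].
Qed.

End Dimension.

(** * Leading terms *)

Section LeadingTerms.
Variables (k : fieldType) (V : lmodType k) (T : eqType) (lt : rel T).
Variables (E : T -> V) (s : seq T).
Hypotheses (lt_trans : transitive lt) (lt_irr : irreflexive lt).
Hypothesis s_sorted : sorted lt s.
Implicit Types W : V -> Prop.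

Definition lower (t : T) (y : V) : Prop :=
  exists2 i, (i \in s) && lt i t & y = E i.

(* The abstract form of "t is the leading monomial of an element of W". *)
Definition leading W (t : T) : Prop :=
  exists2 w, W w & lspan (lower t) (E t - w).

Let span_of (r : seq T) := lspan (fun y => exists2 i, i \in r & y = E i).

Lemma lowerP r1 t r2 : s = rcons r1 t ++ r2 ->
  forall x, lspan (lower t) x <-> span_of r1 x.
Proof.
move=> sE x; have := s_sorted; rewrite sorted_pairwise // sE.
rewrite -cats1 -catA pairwise_cat /= => /and3P[/allrelP lt12 _ /andP[ltt _]].
split; apply: lspan_mono => y [i i_in ->]; exists i => //.
  have:= i_in; rewrite sE -cats1 -catA mem_cat inE => /andP[/or3P[//|/eqP->|]].
    by rewrite lt_irr.
  by move=> /(allP ltt) lti /(lt_trans lti); rewrite lt_irr.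
by rewrite sE -cats1 -catA mem_cat i_in lt12 // mem_head.
Qed.

Lemma span_of_rcons r t x : span_of (rcons r t) x ->
  exists c, span_of r (x - c *: E t).
Proof.
elim=> [|a y {}x [i]]; first by exists 0; rewrite scale0r subr0; apply: lspan0.
rewrite mem_rcons inE => /orP[/eqP ->|ir] -> _ [c IH].
  by exists (a + c); rewrite scalerDl opprD addrACA subrr add0r.
by exists c; rewrite -addrA; apply: lspan_cons => //; exists i.
Qed.

Lemma span_ofS r t x : span_of r x -> span_of (rcons r t) x.
Proof.
by apply: lspan_mono => y [i ir ->]; exists i; rewrite // mem_rcons inE ir orbT.
Qed.

Lemma span_of_last r t : span_of (rcons r t) (E t).
Proof. by apply: lspan_in; exists t; rewrite // mem_rcons mem_head. Qed.

(** Induction on the initial segments of [s]. The family [E] may be dependent: a [t] leading for the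
    zero subspace adds nothing to the span, and any other [t] raises the dimension of the
    intersection with [W] by one exactly when it leads for [W]. *)
Lemma has_dim_leading W :
    subspace W -> (forall x, W x -> span_of s x) ->
  has_dim W (count (fun t => ~~ `[< leading (eq^~ 0) t >] && `[< leading W t
    >]) s).
Proof.
move=> sW Ws; set p := (X in count X).
suff gen r1 r2 : s = r1 ++ r2 ->
    has_dim (fun x => W x /\ span_of r1 x) (count p r1).
  apply: has_dim_ext (gen s [::] _); last by rewrite cats0.
  by move=> x; split=> [[]|Wx] //; split=> //; apply: Ws.
elim/last_ind: r1 r2 => [|r1 t IH] r2 sE.
  apply: has_dim0 => x; split=> [[_]|->]; last first.
    by split; [case: sW | apply: lspan0].
  by elim=> [|a g {}x [i]].
have {}IH := IH (t :: r2); rewrite -cat_rcons in IH; have {}IH := IH sE.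
have low := lowerP sE;
  have sS r : subspace (span_of r) by apply: lspan_subspace.
rewrite -cats1 count_cat /= addn0 {2}/p.
have [[_ ->]|not0] := EM (leading (eq^~ 0) t).
  rewrite subr0 low => Et; rewrite asboolT; last by exists 0;
    rewrite // subr0 low.
  rewrite addn0; apply: has_dim_ext IH => x; split=> -[Wx xr]; split=> //.
    by rewrite cats1; apply: span_ofS.
  move: xr; rewrite cats1 => /span_of_rcons[c xr].
  by rewrite -(subrK (c *: E t) x); apply: subspaceD => //; apply: subspaceZ.
rewrite asboolF //=.
have [[w Ww]|notW] := EM (leading W t); last first.
  rewrite asboolF // addn0; apply: has_dim_ext IH => x.
  split=> -[Wx xr]; split=> //; first by rewrite cats1; apply: span_ofS.
  move: xr; rewrite cats1 => /span_of_rcons[c xr].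
  have [c0|c0] := eqVneq c 0; first by rewrite c0 scale0r subr0 in xr.
  (* An element of [W] with nonzero coefficient [c] at [t] becomes, after rescaling, a witness that
     [t] leads for [W]. *)
  case: notW; exists (c^-1 *: x); first exact: subspaceZ.
  rewrite low -[X in X - _]scale1r -(mulVf c0) -scalerA -scalerBr -opprB.
  by apply: subspaceZ => //; apply: subspaceN.
rewrite low => wt; rewrite asboolT; last by exists w => //; rewrite low.
rewrite addn1; apply: (has_dimS (w := w) IH) => [[_ wr]|x].
  case: not0; exists 0 => //; rewrite subr0 low -(subrK w (E t)).
  exact: subspaceD.
rewrite cats1; split=> [[Wx /span_of_rcons[c xr]]|[c [Wx xr]]].
  exists c; split; first by apply: subspaceB => //; apply: subspaceZ.
  have -> : x - c *: w = x - c *: E t + c *: (E t - w).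
    by rewrite scalerBr addrA subrK.
  by apply: subspaceD => //; apply: subspaceZ.
split.
  by rewrite -(subrK (c *: w) x); apply: subspaceD => //; apply: subspaceZ.
have -> : x = x - c *: w + c *: (E t - (E t - w)) by rewrite subKr subrK.
apply: subspaceD => //; first exact: span_ofS.
apply: subspaceZ => //; apply: subspaceB => //; last exact: span_ofS.
exact: span_of_last.
Qed.

(** Division algorithm: the top term of an element of [W'] is cancelled by a multiple of an element
    of [W], and the remainder lies in the span of a shorter segment. *)
Lemma leading_sub W W' :
    subspace W -> subspace W' -> (forall x, W x -> W' x) ->
    (forall t, t \in s -> leading W' t -> leading W t) ->
  forall x, W' x -> span_of s x -> W x.
Proof.
move=> sW sW' WW' lead;
  have sS r : subspace (span_of r) by apply: lspan_subspace.
suff gen r1 r2 : s = r1 ++ r2 -> forall x, W' x -> span_of r1 x -> W x.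
  by apply: (gen s [::]); rewrite cats0.
elim/last_ind: r1 r2 => [|r1 t IH] r2 sE.
  by move=> x _; elim=> [|a g {}x [i]] //; case: sW.
have {}IH := IH (t :: r2); rewrite -cat_rcons in IH; have {}IH := IH sE.
have low := lowerP sE;
  have ts : t \in s by rewrite sE mem_cat mem_rcons mem_head.
move=> x W'x /span_of_rcons[c xr].
have [c0|c0] := eqVneq c 0; first by rewrite c0 scale0r subr0 in xr; apply: IH.
have /lead : leading W' t.
  exists (c^-1 *: x); first exact: subspaceZ.
  rewrite low -[X in X - _]scale1r -(mulVf c0) -scalerA -scalerBr -opprB.
  by apply: subspaceZ => //; apply: subspaceN.
move=> /(_ ts)[w Ww]; rewrite low => wr.
rewrite -(subrK (c *: w) x); apply: subspaceD => //; last exact: subspaceZ.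
apply: IH; first by apply: subspaceB => //; apply: subspaceZ => //; apply: WW'.
have -> : x - c *: w = x - c *: E t + c *: (E t - w).
  by rewrite scalerBr addrA subrK.
by apply: subspaceD => //; apply: subspaceZ.
Qed.

End LeadingTerms.

(** * Monomials and their count *)

Section Dickson.

Lemma dickson_seq m (L : seq nat -> Prop) :
    (forall x, L x -> size x = m) ->
  exists2 g : seq (seq nat), (forall y, y \in g -> L y) &
    forall x, L x -> exists2 y, y \in g & forall i, (nth 0 y i <= nth 0 x i)%N.
Proof.
elim: m L => [|m IH] L Lm.
  have [L0|nL0] := EM (L [::]).
    exists [:: [::]] => [y|x /Lm/size0nil ->]; first by rewrite inE => /eqP ->.
    by exists [::]; rewrite ?mem_head.
  by exists [::] => // x Lx; case: nL0; rewrite -(size0nil (Lm _ Lx)).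
have [|g' g'L g'P] := IH (fun x => exists a, L (a :: x)).
  by move=> x [a /Lm []].
have /choice[a aP] y : exists a, y \in g' -> L (a :: y).
  by have [/g'L[b] | /negP ny] := boolP (y \in g'); [exists b | exists 0%N].
(* A head that is at least [b] dominates every chosen head [a y], so only tails matter there; the
   heads below [b] give finitely many slices, each covered by induction. *)
pose b := (\max_(y <- g') a y)%N.
have /choice[G GP] c : exists g : seq (seq nat), (forall y, y \in g -> L (c ::
  y)) /\
    forall x, L (c :: x) ->
      exists2 y, y \in g & forall i, (nth 0 y i <= nth 0 x i)%N.
  have [|g ? ?] := IH (fun x => L (c :: x)); first by move=> x /Lm [].
  by exists g.
exists ([seq a y :: y | y <- g'] ++ [seq c :: y | c <- iota 0 b, y <- G c]).
  move=> y; rewrite mem_cat => /orP[/mapP[z /aP Lz ->] //|].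
  by move=> /allpairsPdep[c [z [_ zG ->]]]; apply: (GP c).1.
case=> [/Lm//|c x Lcx]; have [lt_cb | le_bc] := ltnP c b.
  have [y yG yx] := (GP c).2 x Lcx; exists (c :: y) => [|[]//].
  rewrite mem_cat; apply/orP; right; apply/allpairsPdep.
  by exists c, y; rewrite mem_iota.
have [|y yg' yx] := g'P x; first by exists c.
exists (a y :: y) => [|[|i]/=]; first by rewrite mem_cat map_f.
  by apply: leq_trans le_bc; apply: (leq_bigmax_seq (F := a)).
exact: yx.
Qed.

End Dickson.

Section BigradedMonomials.
Variables d n : nat.

(* (a, b) stands for x^a y^b, with a and b the multiexponents in the two groups
   of variables. *)
Definition bmon := ('X_{1..d.+1} *l 'X_{1..n.+1})%type.
Implicit Types x y z : bmon.

Definition badd x y : bmon := ((x.1 + y.1)%MM, (x.2 + y.2)%MM).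
Definition bsub x y : bmon := ((x.1 - y.1)%MM, (x.2 - y.2)%MM).
Definition bdvd x y : bool := (x.1 <= y.1)%MM && (x.2 <= y.2)%MM.

Lemma badd_dvd x y : bdvd x (badd x y).
Proof. by rewrite /bdvd !lem_addr. Qed.

Lemma badd_subK x y : bdvd x y -> badd x (bsub y x) = y.
Proof.
by case: y => y1 y2 /andP[/= le1 le2];
  rewrite /badd /= !(addmC x.1) !(addmC x.2)
  !submK.
Qed.

Lemma baddI x : injective (badd x).
Proof. move=> [y1 y2] [z1 z2] e; have /addmI /= -> := congr1 fst e.
by have /addmI /= -> := congr1 snd e. Qed.

(** With truncated subtraction, [bsub z x] is [z] divided by its gcd with [x], the generator of the
    monomial colon ideal (z : x). *)
Lemma bdvd_badd x y z : bdvd z (badd x y) = bdvd (bsub z x) y.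
Proof.
congr (_ && _); apply/mnm_lepP/mnm_lepP => h i; have := h i;
  by rewrite mnmDE mnmBE leq_subLR.
Qed.

Lemma ltxi_badd x y z : (y < z)%O -> (badd y x < badd z x)%O.
Proof.
case: x y z => [x1 x2] [y1 y2] [z1 z2]; rewrite !ltxi_pair /=.
by rewrite !lemc_add2l ltmc_add2l.
Qed.

Lemma bdickson (L : bmon -> Prop) :
  exists2 g : seq bmon, (forall y, y \in g -> L y) &
    forall x, L x -> exists2 y, y \in g & bdvd y x.
Proof.
pose flat x : seq nat := val (val x.1) ++ val (val x.2).
have szfl x : size (val (val x.1)) = d.+1 by rewrite size_tuple.
have [|g gL gP] := @dickson_seq (d.+1 + n.+1) (fun s => exists2 x, L x & s =
  flat x).
  by move=> _ [x _ ->]; rewrite /flat size_cat !size_tuple.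
have /choice[F FP] s : exists x, s \in g -> L x /\ s = flat x.
  have [/gL[x Lx ->] | /negP ns] := boolP (s \in g); first by exists x.
  by exists (0%MM, 0%MM).
exists [seq F s | s <- g] => [_ /mapP[s /FP[Ls _] ->] //|x Lx].
have [|s sg sx] := gP (flat x); first by exists x.
exists (F s); first exact: map_f.
have [_ sE] := FP s sg; rewrite sE in sx.
apply/andP; split; apply/mnm_lepP => i; rewrite !(mnm_nth 0).
  by have := sx i; rewrite /flat !nth_cat !szfl ltn_ord.
by have := sx (d.+1 + i)%N;
  rewrite /flat !nth_cat !szfl ltnNge leq_addr /= addKn.
Qed.

Definition mons m t : seq 'X_{1..m} := [seq s2m x | x : t.-tuple 'I_m <- enum
  (basis m t)].

Lemma mem_mons m t (a : 'X_{1..m}) : (a \in mons m t) = (mdeg a == t).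
Proof. by rewrite basis_cover. Qed.

Lemma uniq_mons m t : uniq (mons m t). Proof. exact: uniq_basis. Qed.

Lemma size_mons m t : size (mons m.+1 t) = 'C(t + m, m).
Proof. by rewrite size_basis -[in LHS]bin_sub ?leq_addr // addKn. Qed.

Definition bmons u v : seq bmon :=
  sort <=%O [seq ((a, b) : bmon) | a <- mons d.+1 u, b <- mons n.+1 v].

Lemma mem_bmons u v x : (x \in bmons u v) = (mdeg x.1 == u) && (mdeg x.2 == v).
Proof.
rewrite mem_sort; case: x => a b; rewrite -!mem_mons.
by apply/allpairsP/andP => [[[a' b'] [/= ? ? [-> ->]]]|[]] //; exists (a, b).
Qed.

Lemma uniq_bmons u v : uniq (bmons u v).
Proof.
rewrite sort_uniq; apply: allpairs_uniq; try exact: uniq_mons.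
by move=> [a b] [a' b'].
Qed.

Lemma sorted_bmons u v : sorted <%O (bmons u v).
Proof. by rewrite sort_lt_sorted -(sort_uniq <=%O) uniq_bmons. Qed.

Lemma size_bmons u v : size (bmons u v) = ('C(u + d, d) * 'C(v + n, n))%N.
Proof. by rewrite size_sort size_allpairs !size_mons. Qed.

(** Multiplication by [x] is a bijection onto the multiples of [x]; the guard excludes the bidegrees
    where the subtraction would truncate. *)
Lemma count_bdvd x (L : pred bmon) u v :
  count (fun y => bdvd x y && L y) (bmons u v) =
  if (mdeg x.1 <= u)%N && (mdeg x.2 <= v)%N
  then count (fun y => L (badd x y)) (bmons (u - mdeg x.1) (v - mdeg x.2))
  else 0%N.
Proof.
case: ifP => [/andP[le1 le2] | nle]; last first.
  apply/eqP; rewrite -leqn0 leqNgt -has_count; apply/hasPn => y.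
  rewrite mem_bmons => /andP[/eqP yu /eqP yv];
    apply: contraFN nle => /andP[/andP].
  move=> [/submK/(congr1 (@mdeg _)) e1 /submK/(congr1 (@mdeg _)) e2] _.
  by move: e1 e2; rewrite !mdegD yu yv => <- <-; rewrite !leq_addl.
rewrite -!size_filter -[RHS](size_map (badd x)); apply: perm_size;
  apply: uniq_perm.
- by rewrite filter_uniq ?uniq_bmons.
- by rewrite map_inj_uniq ?filter_uniq ?uniq_bmons //; apply: baddI.
move=> y; rewrite mem_filter; apply/andP/mapP => [[/andP[xy Ly]]|[z]].
  rewrite mem_bmons => /andP[/eqP yu /eqP yv]; exists (bsub y x); last first.
    by rewrite badd_subK.
  rewrite mem_filter badd_subK // Ly mem_bmons /=.
  have /andP[/submK e1 /submK e2] := xy.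
  by rewrite -yu -yv -{2}e1 -{2}e2 !mdegD !addnK !eqxx.
rewrite mem_filter mem_bmons => /andP[Lz /andP[/eqP zu /eqP zv]] ->.
by rewrite badd_dvd Lz mem_bmons /= !mdegD zu zv !subnKC ?eqxx.
Qed.

End BigradedMonomials.

Arguments bdvd {d n} x y.

(** * Polynomial growth of monomial counts *)

Section EventuallyPolynomial.
Implicit Types (p q : {poly rat}).

Lemma poly_eventually_ge p : 0 < lead_coef p ->
  exists2 e : rat, 0 < e &
    exists N : nat, forall v, (N <= v)%N -> e <= p.[v%:R].
Proof.
elim/poly_ind: p => [|p c IH]; first by rewrite lead_coef0 ltxx.
have [-> | p0] := eqVneq p 0.
  rewrite mul0r add0r lead_coefC => c0; exists c => //.
  by exists 0%N => v _; rewrite hornerC.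
have sz : (size c%:P < size (p * 'X)%R)%N.
  by rewrite size_mulX // size_polyC (leq_ltn_trans (leq_b1 _)) // ltnS lt0n
    size_poly_eq0.
rewrite lead_coefDl // lead_coefMX => /IH[e e0 [N eN]]; exists e => //.
have e_neq0 : e != 0 by rewrite gt_eqF.
(* Beyond 1 + |c| / e the value of [p * 'X], at least e v, absorbs the constant [c] and still leaves
   [e]. *)
exists (maxn N (Num.bound (1 + `|c| / e))) => v;
  rewrite geq_max => /andP[Nv bv].
rewrite hornerMXaddC.
have ve : 1 + `|c| / e <= v%:R.
  apply: ltW; apply: lt_le_trans (archi_boundP _) _; last by rewrite ler_nat.
  by rewrite addr_ge0 // divr_ge0 // ltW.
have v0 : (0 : rat) <= v%:R by [].
have := ler_wpM2r v0 (eN v Nv).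
have := ler_wpM2l (ltW e0) ve.
rewrite mulrDr mulr1 mulrCA divff // mulr1 => h1 h2.
have := ler_norm (- c); rewrite normrN => h3.
lra.
Qed.

Lemma lead_coef_ge0 p N :
  (forall v, (N <= v)%N -> 0 <= p.[v%:R]) -> 0 <= lead_coef p.
Proof.
move=> p_ge0; rewrite leNgt; apply/negP => lp.
have [|e e0 [N' eN']] := @poly_eventually_ge (- p).
  by rewrite lead_coefN oppr_gt0.
have := p_ge0 _ (leq_maxl N N'); have := eN' _ (leq_maxr N N').
by rewrite hornerN; lra.
Qed.

(** Were [p] of larger degree, [q - p] would have leading coefficient minus that of [p]; both are
    nonnegative, which forces [p] to vanish. *)
Lemma poly_le_size p q N :
    (forall v, (N <= v)%N -> 0 <= p.[v%:R] <= q.[v%:R]) ->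
  (size p <= size q)%N.
Proof.
move=> pq; rewrite leqNgt; apply/negP => lt_qp.
have lp : 0 <= lead_coef p by apply: (@lead_coef_ge0 _ N) => v /pq/andP[].
have := @lead_coef_ge0 (q - p) N; rewrite lead_coefDr ?size_polyN //.
rewrite lead_coefN oppr_ge0 => /(_ _) lp'.
have /eqP : lead_coef p = 0.
  apply/eqP; rewrite eq_le lp lp' // => v /pq/andP[_ le_pq].
  by rewrite hornerD hornerN subr_ge0.
by rewrite lead_coef_eq0 => /eqP p0; rewrite p0 size_poly0 in lt_qp.
Qed.

(** In degree [D] the coefficient of [q - p] is either zero or the leading one. *)
Lemma poly_le_coef p q D N :
    (size p <= D.+1)%N -> (size q <= D.+1)%N ->
    (forall v, (N <= v)%N -> p.[v%:R] <= q.[v%:R]) ->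
  p`_D <= q`_D.
Proof.
move=> sp sq pq; rewrite -subr_ge0 -coefB.
have [sD|sD] := leqP (size (q - p)%R) D; first by rewrite nth_default.
have <- : lead_coef (q - p) = (q - p)`_D.
  suff sz : size (q - p)%R = D.+1 by rewrite lead_coefE sz.
  apply/eqP; rewrite eqn_leq sD andbT (leq_trans (size_polyD _ _)) //.
  by rewrite size_polyN geq_max sq sp.
by apply: (@lead_coef_ge0 _ N) => v /pq; rewrite hornerD hornerN subr_ge0.
Qed.

(** This is C(X + m, m), the Hilbert polynomial of a polynomial ring in m + 1 variables. *)
Fixpoint binpoly m : {poly rat} :=
  if m is m'.+1 then (m%:R^-1) *: (binpoly m' * ('X + m%:R%:P)) else 1.

Lemma horner_binpoly m t : (binpoly m).[t%:R] = 'C(t + m, m)%:R.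
Proof.
elim: m => [|m IH]; first by rewrite hornerC addn0 bin0.
rewrite [binpoly _]/= hornerZ hornerM IH hornerD hornerX hornerC
  -natrD -natrM.
have := mul_bin_diag (t + m.+1) m; rewrite addnS [X in 'C(X, m)]/= => e.
by rewrite mulnC e natrM mulKf // pnatr_eq0.
Qed.

Lemma size_binpoly m : size (binpoly m) = m.+1.
Proof.
elim: m => [|m IH]; first by rewrite size_poly1.
rewrite [binpoly _]/= size_scale ?invr_eq0 ?pnatr_eq0 //.
by rewrite size_Mmonic ?monicXaddC // -?size_poly_eq0 ?IH // size_XaddC addn2.
Qed.

Lemma lead_coef_binpoly_gt0 m : 0 < lead_coef (binpoly m).
Proof.
elim: m => [|m IH]; first by rewrite lead_coef1.
rewrite [binpoly _]/= lead_coefZ lead_coef_Mmonic ?monicXaddC //.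
by rewrite mulr_gt0 // invr_gt0 ltr0n.
Qed.

(* The second clause is not a consequence of the first: there the first argument
   need not be large. *)
Definition evpoly (F : nat -> nat -> rat) : Prop :=
  (exists P : {poly {poly rat}}, exists N : nat,
     forall u v, (N <= u)%N -> (N <= v)%N -> F u v = P.[u%:R, v%:R]) /\
  (exists N : nat, forall u, exists p : {poly rat},
     forall v, (N <= v)%N -> F u v = p.[v%:R]).

Lemma eq_evpoly F G : (forall u v, F u v = G u v) -> evpoly F -> evpoly G.
Proof.
move=> FG [[P [N PN]] [N' pN']]; split.
  by exists P, N => u v ? ?; rewrite -FG PN.
by exists N' => u; have [p pE] := pN' u; exists p => v ?; rewrite -FG pE.
Qed.

Lemma evpoly_lin a F G :
  evpoly F -> evpoly G -> evpoly (fun u v => F u v + a * G u v).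
Proof.
move=> [[P [N PN]] [N1 pN1]] [[Q [M QM]] [M1 qM1]]; split.
  exists (P + a%:P%:P * Q), (maxn N M) => u v.
  rewrite !geq_max => /andP[Nu Mu] /andP[Nv Mv].
  by rewrite PN // QM // hornerD hornerM hornerC hornerD hornerM hornerC.
exists (maxn N1 M1) => u; have [[p pE] [q qE]] := (pN1 u, qM1 u).
exists (p + a%:P * q) => v; rewrite geq_max => /andP[Nv Mv].
by rewrite pE // qE // hornerD hornerM hornerC.
Qed.

Lemma evpoly0 : evpoly (fun _ _ => 0).
Proof.
by split; [exists 0, 0%N => u v _ _ | exists 0%N => u; exists 0 => v _];
  rewrite !horner0.
Qed.

Lemma evpoly_shift a b F : evpoly F ->
  evpoly (fun u v => if (a <= u)%N && (b <= v)%N then F (u - a)%N (v - b)%N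
    else 0).
Proof.
move=> [[P [N PN]] [N1 pN1]].
(* The shift of the inner variable is a ring morphism, so it can be mapped over the coefficients of
   [P] and commutes with evaluation of the outer variable. *)
pose phi : {rmorphism {poly rat} -> {poly rat}} := comp_poly ('X - b%:R%:P).
have hphi p v : (b <= v)%N -> (phi p).[v%:R] = p.[(v - b)%N%:R].
  by move=> bv; rewrite horner_comp hornerXsubC natrB.
split.
  exists (map_poly phi P \Po ('X - a%:R%:P%:P)), (N + maxn a b)%N => u v Nu Nv.
  have [au bv] : (a <= u /\ b <= v)%N by split; lia.
  rewrite au bv PN; try lia.
  rewrite horner_comp hornerD hornerN hornerX hornerC -rmorphB /= -natrB //.
  transitivity (map_poly phi P).[phi (u - a)%N%:R%:P].[v%:R].
    by rewrite horner_map hphi.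
  by rewrite /= comp_polyC.
exists (N1 + b)%N => u; have [p pE] := pN1 (u - a)%N.
exists (if (a <= u)%N then phi p else 0) => v Nv.
have bv : (b <= v)%N by lia.
rewrite bv andbT; case: ifP => _; last by rewrite horner0.
by rewrite hphi // pE //; lia.
Qed.

Lemma evpoly_bin d n : evpoly (fun u v => ('C(u + d, d) * 'C(v + n, n))%N%:R).
Proof.
split.
  exists (map_poly polyC (binpoly d) * (binpoly n)%:P), 0%N => u v _ _.
  by rewrite hornerM horner_map hornerC hornerM hornerC !horner_binpoly natrM.
exists 0%N => u; exists (('C(u + d, d)%:R)%:P * binpoly n) => v _.
by rewrite hornerM hornerC horner_binpoly natrM.
Qed.

(** Inclusion-exclusion on one generator [y]: the multiples of [y] that are also multiples of some
    [z] in [g] are [y] times the multiples of the colon monomials [bsub z y]. *)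
Lemma evpoly_bmons_gen d n (g : seq (bmon d n)) :
  evpoly (fun u v => (count (fun x => has (bdvd^~ x) g) (bmons d n u v))%:R).
Proof.
(* The induction is on a bound for the length, since the hypothesis is applied both to [g] and to
   the list [g'] of colon monomials. *)
elim: {g}(size g) {-2}g (leqnn (size g)) => [|m IH] [|y g] //= sg;
  try by apply: eq_evpoly evpoly0 => u v; rewrite count_pred0.
pose g' := [seq bsub z y | z <- g].
pose F1 u v : rat := (count (fun x => bdvd y x && true) (bmons d n u v))%:R.
pose F2 u v : rat :=
  (count (fun x => bdvd y x && has (bdvd^~ x) g) (bmons d n u v))%:R.
have := evpoly_lin (-1) (_ : evpoly F1) (_ : evpoly F2).
have e1 : evpoly F1.
  apply: eq_evpoly (evpoly_shift (mdeg y.1) (mdeg y.2) (evpoly_bin d n)) => u v.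
  by rewrite /F1 count_bdvd count_predT size_bmons; case: ifP.
have e2 : evpoly F2.
  have gm : (size g' <= m)%N by rewrite size_map.
  apply: eq_evpoly (evpoly_shift (mdeg y.1) (mdeg y.2) (IH _ gm)) => u v.
  rewrite /F2 count_bdvd; case: ifP => // _; congr (_%:R).
  apply: eq_count => x; rewrite has_map; apply: eq_has => z /=.
  by rewrite bdvd_badd.
move=> /(_ e1 e2)/evpoly_lin/(_ (IH _ sg)) h.
apply: eq_evpoly (h 1) => u v; rewrite /F1 /F2 mulN1r mul1r.
have := count_predUI (bdvd y) (fun x => has (bdvd^~ x) g) (bmons d n u v).
move=> /(congr1 (fun i : nat => i%:R : rat)); rewrite !natrD => e.
rewrite addrAC (eq_count (a2 := bdvd y)); last by move=> x; rewrite /= andbT.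
rewrite -e; apply/eqP; rewrite subr_eq; apply/eqP.
by congr (_%:R + _%:R); apply: eq_count.
Qed.

(* By Dickson's lemma L is the set of multiples of finitely many monomials, and
   inclusion-exclusion on these expresses the count by shifted binomials. *)
Lemma evpoly_bmons d n (L : pred (bmon d n)) :
    (forall x y, L x -> L (badd x y)) ->
  evpoly (fun u v => (count L (bmons d n u v))%:R).
Proof.
move=> L_up; have [g gL gP] := @bdickson d n L.
apply: eq_evpoly (evpoly_bmons_gen g) => u v; congr (_%:R).
apply: eq_count => x /=; apply/hasP/idP => [[y /gL Ly yx]|/gP[y]];
  last by exists y.
by rewrite -(badd_subK yx); apply: L_up.
Qed.

End EventuallyPolynomial.

(** * Rees algebra and saturation *)

Section IdealPowers.
Variables (k : fieldType) (d n : nat).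
Local Notation R := {mpoly k[d.+1]}.
Implicit Types (f : n.+1.-tuple R) (p q r : R).

Lemma mulr_linear r : linear (fun p => r * p).
Proof. by move=> a p q; rewrite mulrDr scalerAr. Qed.

Lemma mull_linear r : linear (fun p => p * r).
Proof. by move=> a p q; rewrite mulrDl scalerAl. Qed.

Lemma mulr_eq0_inj r (W : R -> Prop) :
  r != 0 -> forall p, W p -> r * p = 0 -> p = 0.
Proof.
by move=> r0 p _ /eqP; rewrite mulf_eq0 (negbTE r0) => /eqP.
Qed.

Definition fpow f (b : 'X_{1..n.+1}) : R := 'X_[b] \mPo f.

Lemma fpow0 f : fpow f 0%MM = 1.
Proof. by rewrite /fpow mpolyX0 comp_mpoly1. Qed.

Lemma fpowD f a b : fpow f (a + b)%MM = fpow f a * fpow f b.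
Proof. by rewrite /fpow mpolyXD rmorphM. Qed.

Lemma fpowU f i : fpow f U_(i)%MM = tnth f i.
Proof. by rewrite /fpow comp_mpolyXU -tnth_nth. Qed.

Lemma mdeg_ind m (P : nat -> 'X_{1..m} -> Prop) :
    P 0%N 0%MM -> (forall t i a, mdeg a = t -> P t a -> P t.+1 (U_(i) + a)%MM)
      ->
  forall t a, mdeg a = t -> P t a.
Proof.
move=> P0 PS; elim=> [a /eqP|t IH a da]; first by rewrite mdeg_eq0 => /eqP ->.
have /existsP[i ai] : [exists i, a i != 0%N].
  apply: contra_eqT da; rewrite negb_exists => /forallP a0.
  by rewrite mdegE big1 // => i _; apply/eqP; have := a0 i; rewrite negbK.
have ia : (U_(i) <= a)%MM by rewrite lep1mP.
have da' : mdeg (a - U_(i))%MM = t.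
  by move: da; rewrite -{1}(submK ia) mdegD mdeg1 addn1 => -[].
by rewrite -(submK ia) addmC; apply: PS => //; apply: IH.
Qed.

Lemma fpow_homog f delta b : (forall j, tnth f j \is delta.-homog) ->
  fpow f b \is (mdeg b * delta).-homog.
Proof.
move=> hf; move: {2}(mdeg b) (erefl (mdeg b)) => t;
  elim/mdeg_ind: t b / => [|t i a da IH].
  by rewrite fpow0 mdeg0 mul0n; apply: dhomog1.
by rewrite fpowD fpowU mdegD mdeg1 mulnDl mul1n; apply: dhomogM.
Qed.

Lemma ideal_gen0 G : ideal_gen G (0 : R).
Proof. by exists [::]; rewrite big_nil. Qed.

Lemma ideal_genD G p q : ideal_gen G p -> ideal_gen G q -> ideal_gen G (p + q).
Proof.
move=> [s [sG ->]] [s' [s'G ->]]; exists (s ++ s'); rewrite big_cat;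
  split=> // x.
by rewrite mem_cat => /orP[/sG|/s'G].
Qed.

Lemma ideal_genM G r p : ideal_gen G p -> ideal_gen G (r * p).
Proof.
move=> [s [sG ->]]; exists [seq (r * x.1, x.2) | x <- s].
split; first by move=> _ /mapP[x /sG Gx ->].
by rewrite big_map mulr_sumr; apply: eq_bigr => x _; rewrite mulrA.
Qed.

Lemma ideal_gen_in G p : ideal_gen G p -> forall W : R -> Prop, subspace W ->
  (forall r g, G g -> W (r * g)) -> W p.
Proof.
move=> [s [sG ->]] W sW GW; apply: subspace_sum_seq => // x /sG Gx.
exact: GW.
Qed.

Lemma ideal_gen_gen G p : G p -> ideal_gen G p.
Proof.
move=> Gp; exists [:: (1, p)]; rewrite big_seq1 mul1r; split=> // x.
by rewrite inE => /eqP ->.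
Qed.

Lemma ideal_exp0 (I : R -> Prop) v : ideal_exp I v 0.
Proof. by case: v => // v; apply: ideal_gen0. Qed.

Lemma ideal_expD (I : R -> Prop) v p q :
  ideal_exp I v p -> ideal_exp I v q -> ideal_exp I v (p + q).
Proof. by case: v => // v; apply: ideal_genD. Qed.

Lemma ideal_expM (I : R -> Prop) v r p :
  ideal_exp I v p -> ideal_exp I v (r * p).
Proof. by case: v => // v; apply: ideal_genM. Qed.

Lemma ideal_exp_subspace (I : R -> Prop) v : subspace (ideal_exp I v).
Proof.
split=> [|a p q Ip Iq]; first exact: ideal_exp0.
by apply: ideal_expD => //; rewrite -mul_mpolyC; apply: ideal_expM.
Qed.

Definition fmonomial f v p : Prop := exists2 b, mdeg b = v &
  exists a, p = 'X_[a] * fpow f b.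

Lemma lspan_fmonomialM f v r p :
  lspan (fmonomial f v) p -> lspan (fmonomial f v) (r * p).
Proof.
move=> pI; rewrite [r]mpolyE mulr_suml.
apply: subspace_sum; [exact: lspan_subspace | move=> m _].
rewrite -scalerAl; apply: subspaceZ; first exact: lspan_subspace.
elim: pI => [|c g {}p [b bv [a ->]] _ IH].
  by rewrite mulr0; apply: lspan0.
rewrite mulrDr -scalerAr; apply: lspan_cons => //.
by exists b => //; exists (m + a)%MM; rewrite mpolyXD mulrA.
Qed.

Lemma lspan_fmonomial_fM f v j p :
  lspan (fmonomial f v) p -> lspan (fmonomial f v.+1) (tnth f j * p).
Proof.
apply: lspan_linear; [exact: mulr_linear | exact: lspan_subspace |].
move=> _ [b bv [a ->]]; apply: lspan_in.
exists (U_(j) + b)%MM; first by rewrite mdegD mdeg1 bv.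
by exists a; rewrite fpowD fpowU mulrCA.
Qed.

(** Powers of the base ideal become spans over [k], so that linear statements about them can be
    checked on the products x^a f^b. *)
Lemma ideal_exp_baseP f v p :
  ideal_exp (base_ideal f) v p <-> lspan (fmonomial f v) p.
Proof.
split; last first.
  apply: lspan_sub; first exact: ideal_exp_subspace.
  move=> _ [b bv [a ->]]; apply: ideal_expM.
  elim/mdeg_ind: v b / bv => // v j b bv IH; apply: ideal_gen_gen.
  exists (tnth f j), (fpow f b); split=> //; last by rewrite fpowD fpowU.
  by apply: ideal_gen_gen; exists j.
elim: v p => [|v IH] p.
  move=> _; rewrite [p]mpolyE; apply: subspace_sum; first exact: lspan_subspace.
  move=> m _; apply: subspaceZ; first exact: lspan_subspace.
  apply: lspan_in; exists 0%MM; first by rewrite mdeg0.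
  by exists m; rewrite fpow0 mulr1.
move/ideal_gen_in; apply; first exact: lspan_subspace.
move=> r _ [a [b [aI bI ->]]]; apply: lspan_fmonomialM.
have linb := mull_linear b; have sS := lspan_subspace (fmonomial f v.+1).
case: aI => s [sI ->]; rewrite mulr_suml; apply: subspace_sum_seq => // x.
move=> /sI[j ->]; rewrite -mulrA; apply: lspan_fmonomialM.
by apply: lspan_fmonomial_fM; apply: IH.
Qed.

Lemma ideal_exp_mul f v w p q :
    ideal_exp (base_ideal f) v p -> ideal_exp (base_ideal f) w q ->
  ideal_exp (base_ideal f) (v + w) (p * q).
Proof.
move=> pI qI; have := ideal_exp_subspace (base_ideal f) (v + w) => sI.
move: pI => /ideal_exp_baseP; move: p; apply: lspan_linear sI _ => //.
  exact: mull_linear.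
move=> _ [b bv [a ->]]; rewrite -mulrA; apply: ideal_expM.
move: qI => /ideal_exp_baseP; move: q; apply: lspan_linear.
- exact: mulr_linear.
- exact: ideal_exp_subspace.
move=> _ [c cw [a' ->]]; rewrite mulrCA; apply: ideal_expM.
apply/ideal_exp_baseP/lspan_in; exists (b + c)%MM; first by rewrite mdegD bv cw.
by exists 0%MM; rewrite mpolyX0 mul1r fpowD.
Qed.

End IdealPowers.

Section Saturation.
Variables (k : fieldType) (d : nat).
Local Notation R := {mpoly k[d.+1]}.

Lemma ideal_exp_irrelevantP N (p : R) :
  ideal_exp (@irrelevant_ideal k d) N p <->
  lspan (fun y => exists2 b, mdeg b = N & exists a, y = 'X_[a] * 'X_[b]) p.
Proof.
(* The irrelevant ideal is the base ideal of the tuple of variables, so the description of powers of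
   base ideals applies to it. *)
have -> : @irrelevant_ideal k d = base_ideal [tuple 'X_i | i < d.+1].
  rewrite /irrelevant_ideal /base_ideal; congr ideal_gen.
  apply/funext => q; apply/propext; split=> -[i ->]; exists i;
    by rewrite tnth_mktuple.
rewrite ideal_exp_baseP; split; apply: lspan_mono => _ [b bN [a ->]];
  by exists b => //; exists a; rewrite /fpow comp_mpoly_id.
Qed.

Lemma mnm_le_mdeg m N (a : 'X_{1..m}) :
  (N <= mdeg a)%N -> exists2 b, mdeg b = N & (b <= a)%MM.
Proof.
elim: N => [|N IH] Na.
  by exists 0%MM; [rewrite mdeg0 | apply/mnm_lepP => i; rewrite mnm0E].
have [b bN ba] := IH (ltnW Na).
have /existsP[i abi] : [exists i, (a - b)%MM i != 0%N].
  apply: contraLR Na; rewrite negb_exists => /forallP ab0.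
  rewrite -leqNgt -(submK ba) mdegD bN -[leqRHS]add0n leq_add2r leqn0.
  by rewrite mdegE big1 // => i _; apply/eqP; have := ab0 i; rewrite negbK.
exists (U_(i) + b)%MM; first by rewrite mdegD mdeg1 bN.
rewrite -(submK ba); apply/mnm_lepP => j; rewrite !mnmDE leq_add2r mnm1E.
by case: eqP => // <-; rewrite lt0n.
Qed.

(** A condition on all monomials of degree at least [N] survives enlarging [N], so two such bounds
    merge into their maximum. *)
Lemma ideal_sat_irrelevantP (I : R -> Prop) v p :
  ideal_sat (ideal_exp I v) (@irrelevant_ideal k d) p <->
  exists N, forall a, (N <= mdeg a)%N -> ideal_exp I v ('X_[a] * p).
Proof.
split=> -[N NP]; exists N => a aP.
  have [b bN ba] := mnm_le_mdeg aP; apply: NP.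
  apply/ideal_exp_irrelevantP/lspan_in; exists b => //.
  by exists (a - b)%MM; rewrite -mpolyXD submK.
move: aP => /ideal_exp_irrelevantP; move: a; apply: lspan_linear.
- exact: mull_linear.
- exact: ideal_exp_subspace.
move=> _ [b bN [a ->]]; rewrite -mulrA; apply/ideal_expM/NP.
by rewrite bN.
Qed.

End Saturation.

(** * Bigraded modules over the Rees algebra *)

Section ReesAlgebra.
Variables (k : fieldType) (d n delta : nat).
Local Notation R := {mpoly k[d.+1]}.
Local Notation bmon := (bmon d n).
Local Notation bmons := (bmons d n).
Variable f : n.+1.-tuple R.
Hypothesis f_homog : forall j, tnth f j \is delta.-homog.
Implicit Types (p q : R) (x y z : bmon) (W : nat -> nat -> R -> Prop).

Local Notation Q := (rees_piece f delta).
Local Notation I_ := (ideal_exp (base_ideal f)).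
Local Notation x0 := ('X_ord0 : R).

Definition beval x : R := 'X_[x.1] * fpow f x.2.

Lemma beval_badd x y : beval (badd x y) = beval y * beval x.
Proof. by rewrite /beval mpolyXD fpowD mulrACA mulrC. Qed.

Lemma graded_subspace (I : R -> Prop) w :
  subspace I -> subspace (graded_piece I w).
Proof.
move=> [I0 ID]; split; first by split=> //; apply: dhomog0.
move=> a q r [Iq hq] [Ir hr]; split; first exact: ID.
by apply: dhomogD => //; apply: dhomogZ.
Qed.

Lemma rees_subspace u v : subspace (Q u v).
Proof. by apply: graded_subspace; apply: ideal_exp_subspace. Qed.

Lemma beval_homog x : beval x \is (mdeg x.1 + mdeg x.2 * delta).-homog.
Proof. by apply: dhomogM; [rewrite dhomogX | apply: fpow_homog]. Qed.

Lemma beval_ideal x : I_ (mdeg x.2) (beval x).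
Proof. by apply/ideal_exp_baseP/lspan_in; exists x.2 => //; exists x.1. Qed.

Lemma beval_in_rees u v x : mdeg x.1 = u -> mdeg x.2 = v -> Q u v (beval x).
Proof. by move=> <- <-; split; [apply: beval_ideal | apply: beval_homog]. Qed.

Lemma rees_pieceP u v p :
  Q u v p <-> lspan (fun q => exists2 x, x \in bmons u v & q = beval x) p.
Proof.
split=> [[/ideal_exp_baseP pI hp]|].
  (* Project onto degree u + v delta: a product x^a f^b with |b| = v is homogeneous, so it survives
     only when |a| = u and otherwise maps to zero. *)
  rewrite -(pihomog_dE hp); move: p pI {hp}; apply: lspan_linear.
  - exact: linearP.
  - exact: lspan_subspace.
  move=> _ [b bv [a ->]].
  have h : 'X_[a] * fpow f b \is (mdeg a + v * delta).-homog.
    by apply: dhomogM; [rewrite dhomogX | rewrite -bv; apply: fpow_homog].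
  have [e|ne] := eqVneq (mdeg a + v * delta)%N (u + v * delta)%N; last first.
    by rewrite (pihomog_ne0 ne h); apply: lspan0.
  rewrite -e pihomog_dE //; apply: lspan_in; exists (a, b) => //.
  by rewrite mem_bmons bv eqxx andbT -(eqn_add2r (v * delta)) e.
apply: lspan_sub; first exact: rees_subspace.
move=> _ [x xM ->]; move: xM; rewrite mem_bmons => /andP[/eqP xu /eqP xv].
exact: beval_in_rees.
Qed.

Lemma reesM u v u' v' p q : Q u v p -> Q u' v' q -> Q (u + u') (v + v') (p * q).
Proof.
move=> [pI hp] [qI hq]; split; first exact: ideal_exp_mul.
by rewrite mulnDl addnACA; apply: dhomogM.
Qed.

(** Only stability under the Rees algebra is asked, so that the saturated pieces, which need not lie
    in [Q], are an instance. *)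
Definition bimodule W : Prop := (forall u v, subspace (W u v)) /\
  forall x u v p, W u v p -> W (u + mdeg x.1)%N (v + mdeg x.2)%N (beval x * p).

Lemma bimodule0 : bimodule (fun _ _ => eq^~ 0).
Proof.
by split=> [u v|x u v p ->]; [apply: subspace_eq0 | rewrite mulr0].
Qed.

Lemma rees_bimodule : bimodule Q.
Proof.
split=> [|x u v p pQ]; first exact: rees_subspace.
by rewrite mulrC; apply: reesM => //; apply: beval_in_rees.
Qed.

(** The submodule x0^t W, which vanishes in x-degree below [t]. *)
Definition xshift t W u v p : Prop :=
  if (t <= u)%N then exists2 q, W (u - t)%N v q & p = x0 ^+ t * q else p = 0.

Lemma xshift_bimodule t W : bimodule W -> bimodule (xshift t W).
Proof.
move=> [sW WM]; split=> [u v|x u v p]; rewrite /xshift.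
  case: (t <= u)%N; last exact: subspace_eq0.
  split; first by exists 0; [case: (sW (u - t)%N v) | rewrite mulr0].
  move=> a p q [p' Wp' ->] [q' Wq' ->]; exists (a *: p' + q').
    by case: (sW (u - t)%N v) => _; apply.
  by rewrite mulrDr scalerAr.
case: ifP => [tu [q Wq ->]|_ ->].
  rewrite (leq_trans tu (leq_addr _ _)) mulrCA; exists (beval x * q) => //.
  by rewrite -addnBAC //; apply: WM.
rewrite mulr0; case: ifP => // _; exists 0; last by rewrite mulr0.
by case: (sW (u + mdeg x.1 - t)%N (v + mdeg x.2)%N).
Qed.

Definition lead W x : Prop :=
  leading <%O beval (bmons (mdeg x.1) (mdeg x.2)) (W (mdeg x.1) (mdeg x.2)) x.

Lemma lower_beval x z p :
  lspan (lower <%O beval (bmons (mdeg x.1) (mdeg x.2)) x) p ->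
  lspan (lower <%O beval (bmons (mdeg x.1 + mdeg z.1) (mdeg x.2 + mdeg z.2))
    (badd x z)) (beval z * p).
Proof.
apply: lspan_linear; [exact: mulr_linear | exact: lspan_subspace |].
move=> _ [y /andP[yM lt_yx] ->]; move: yM; rewrite mem_bmons.
move=> /andP[/eqP y1 /eqP y2].
apply: lspan_in; exists (badd y z); last by rewrite beval_badd.
by rewrite mem_bmons /= !mdegD y1 y2 !eqxx ltxi_badd.
Qed.

Lemma lead_badd W' x z w :
    lspan (lower <%O beval (bmons (mdeg x.1) (mdeg x.2)) x) (beval x - w) ->
    W' (mdeg x.1 + mdeg z.1)%N (mdeg x.2 + mdeg z.2)%N (beval z * w) ->
  lead W' (badd x z).
Proof.
move=> low W'w; rewrite /lead /= !mdegD; exists (beval z * w) => //.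
by rewrite beval_badd -mulrBr; apply: lower_beval.
Qed.

Lemma lead_up W x z : bimodule W -> lead W x -> lead W (badd x z).
Proof. by move=> [_ WM] [w Ww low]; apply: (lead_badd low); apply: WM. Qed.

(** Monomials leading for 0 also lead for [W], so the dimension is a difference of two counts over
    sets closed under multiplication. *)
Lemma has_dim_evpoly W :
    bimodule W -> (forall u v p, W u v p -> Q u v p) ->
  exists2 h : nat -> nat -> nat, (forall u v, has_dim (W u v) (h u v)) &
    evpoly (fun u v => (h u v)%:R).
Proof.
move=> mW WQ; pose Z x := `[< lead (fun _ _ => eq^~ 0) x >].
pose L x := `[< lead W x >].
exists (fun u v => count (fun x => ~~ Z x && L x) (bmons u v)) => [u v|].
  have e : {in bmons u v, (fun x =>
      ~~ `[< leading <%O beval (bmons u v) (eq^~ 0) x >] &&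
      `[< leading <%O beval (bmons u v) (W u v) x >]) =1
      (fun x => ~~ Z x && L x)}.
    by move=> x; rewrite mem_bmons /L /Z /lead => /andP[/eqP -> /eqP ->].
  rewrite -(eq_in_count e); apply: has_dim_leading.
  - exact: lt_trans.
  - exact: lt_irreflexive.
  - exact: sorted_bmons.
  - by case: mW.
  by move=> p /WQ/rees_pieceP.
have ZL x : Z x -> L x.
  move=> /asboolP[w -> low]; apply/asboolP; exists 0 => //.
  by case: mW => sW _; case: (sW (mdeg x.1) (mdeg x.2)).
have up W' : bimodule W' -> evpoly (fun u v =>
    (count (fun x => `[< lead W' x >]) (bmons u v))%:R).
  move=> mW'; apply: evpoly_bmons => x y /asboolP lx; apply/asboolP.
  exact: lead_up.
apply: eq_evpoly (evpoly_lin (-1) (up _ mW) (up _ bimodule0)) => u v.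
rewrite mulN1r -/Z; apply/eqP; rewrite subr_eq -natrD eqr_nat; apply/eqP.
elim: (bmons u v) => //= x s ->; rewrite -/(Z x) -/(L x).
by case: (Z x) (@ZL x) => [->|_] //; case: (L x); rewrite /=; lia.
Qed.

(** Modulo x0 Q these are the classes killed by a power of the irrelevant ideal, that is, the zeroth
    local cohomology of Q / x0 Q. *)
Definition xcolon u v p : Prop := Q u v p /\ exists N, forall a,
  (N <= mdeg a)%N -> xshift 1 Q (u + mdeg a)%N v ('X_[a] * p).

Let mX1 : bimodule (xshift 1 Q). Proof. exact/xshift_bimodule/rees_bimodule.
  Qed.

Lemma bimoduleX W a u v p : bimodule W -> W u v p ->
  W (u + mdeg a)%N v ('X_[a] * p).
Proof.
move=> [_ WM] /(WM (a, 0%MM)).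
by rewrite /beval /= fpow0 mulr1 mdeg0 addn0.
Qed.

Lemma bimodulef W b u v p : bimodule W -> W u v p ->
  W u (v + mdeg b)%N (fpow f b * p).
Proof.
move=> [_ WM] /(WM (0%MM, b)).
by rewrite /beval /= mpolyX0 mul1r mdeg0 addn0.
Qed.

Lemma xcolon_bimodule : bimodule xcolon.
Proof.
have [sX XM] := mX1; have [sQ QM] := rees_bimodule.
split=> [u v|x u v p [Qp [N NP]]].
  split.
    by split; [case: (sQ u v) | exists 0%N => a _; rewrite mulr0;
      case: (sX (u + mdeg a)%N v)].
  move=> c p q [Qp [N NP]] [Qq [M MP]]; split; first by case: (sQ u v) => _;
    apply.
  exists (maxn N M) => a; rewrite geq_max => /andP[Na Ma].
  rewrite mulrDr -scalerAr; case: (sX (u + mdeg a)%N v) => _; apply.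
    exact: NP.
  exact: MP.
split; first exact: QM.
by exists N => a /NP Xp; rewrite mulrCA addnAC; apply: XM.
Qed.

Lemma xshift1_sub u v p : xshift 1 Q u v p -> Q u v p.
Proof.
rewrite /xshift; case: ifP => [u0 [q Qq ->]|_ ->];
  last by case: (rees_subspace u v).
have := bimoduleX U_(ord0)%MM rees_bimodule Qq.
by rewrite mdeg1 subnK.
Qed.

(* The torsion of Q / x0 Q is finitely generated, hence killed by a power of the
   irrelevant ideal, hence zero in large x-degree; on leading monomials. *)
Lemma xcolon_large :
  exists u1, forall u v p, (u1 <= u)%N -> xcolon u v p -> xshift 1 Q u v p.
Proof.
have [g gL gP] := bdickson (lead xcolon).
have /choice[N NP] y : exists N, y \in g -> exists2 w,
    (forall a, (N <= mdeg a)%N ->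
       xshift 1 Q (mdeg y.1 + mdeg a)%N (mdeg y.2) ('X_[a] * w)) &
    lspan (lower <%O beval (bmons (mdeg y.1) (mdeg y.2)) y) (beval y - w).
  have [/gL[w [_ [N NP]] low]|/negP ny] := boolP (y \in g); last by exists 0%N.
  by exists N => _; exists w.
(* Above this bound the cofactor [z] of a generator [y] has x-degree at least [N y], enough to carry
   the witness [w] of [y] into x0 Q. *)
exists (\max_(y <- g) (mdeg y.1 + N y))%N => u v p u1u.
have [sX XM] := mX1; have [sC CM] := xcolon_bimodule.
move=> pC; apply: (leading_sub (E := beval) (@lt_trans _ _) (@lt_irreflexive _
  _)
  (sorted_bmons d n u v) (sX u v) (sC u v) _ _ pC); last first.
- by case: pC => /rees_pieceP.
- move=> x; rewrite mem_bmons => /andP[/eqP xu /eqP xv] lx.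
  have /gP[y yg yx] : lead xcolon x by rewrite /lead xu xv.
  have [w wX low] := NP y yg; have xE := badd_subK yx.
  pose z := bsub x y; have [zu zv] : u = (mdeg y.1 + mdeg z.1)%N /\
      v = (mdeg y.2 + mdeg z.2)%N by rewrite -xu -xv -xE /= !mdegD.
  suff : lead (xshift 1 Q) x by rewrite /lead xu xv.
  rewrite -xE; apply: (lead_badd low); rewrite -/z /beval mulrAC mulrC.
  apply: bimodulef => //; apply: wX; rewrite -(leq_add2l (mdeg y.1)) -zu.
  by apply: leq_trans u1u; apply: (leq_bigmax_seq (F := fun y => _)).
move=> q qX; split; first exact: xshift1_sub.
by exists 0%N => a _; apply: bimoduleX.
Qed.

(** The saturated special fiber ring is the row u = 0; the other rows make room for multiplication
    by x0. *)
Definition sat_piece u v : R -> Prop :=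
  graded_piece (ideal_sat (I_ v) (@irrelevant_ideal k d)) (u + v * delta).

Lemma sat_bimodule : bimodule sat_piece.
Proof.
split=> [u v|x u v p [pI hp]].
  apply: graded_subspace; have [I0 ID] := ideal_exp_subspace (base_ideal f) v.
  split; first by exists 0%N => a _; rewrite mulr0.
  move=> c p q /ideal_sat_irrelevantP[N NP] /ideal_sat_irrelevantP[M MP].
  apply/ideal_sat_irrelevantP; exists (maxn N M) => a.
  rewrite geq_max => /andP[/NP Na /MP Ma].
  by rewrite mulrDr -scalerAr; apply: ID.
split; last first.
  rewrite mulrC mulnDl addnACA; apply: dhomogM => //; exact: beval_homog.
apply/ideal_sat_irrelevantP; move: pI => /ideal_sat_irrelevantP[N NP].
exists N => a /NP Ia; rewrite mulrCA mulrC.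
by apply: ideal_exp_mul => //; apply: beval_ideal.
Qed.

(** Some x0^M p lies in [Q], and the power can be lowered: x0^(M+1) p is in [xcolon], hence in x0 Q
    once its x-degree is large, and x0 cancels. *)
Lemma sat_large :
  exists u1, forall u v p, (u1 <= u)%N -> sat_piece u v p -> Q u v p.
Proof.
have [u1 u1P] := xcolon_large; exists u1 => u v p u1u [].
move=> /ideal_sat_irrelevantP[N NP] hp.
have XQ a : (N <= mdeg a)%N -> Q (u + mdeg a)%N v ('X_[a] * p).
  move=> Na; split; first exact: NP.
  by rewrite addnAC addnC; apply: dhomogM => //; rewrite dhomogX.
have xE M : 'X_[U_(ord0) *+ M] = x0 ^+ M :> R by rewrite mpolyXn.
have dE M : mdeg (U_(ord0 : 'I_d.+1) *+ M)%MM = M by rewrite mdegMn mdeg1 mul1n.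
suff down M : Q (u + M)%N v (x0 ^+ M * p) -> Q u v p.
  by apply: (down N); have := XQ (U_(ord0) *+ N)%MM; rewrite xE dE; apply.
elim: M => [|M IH]; first by rewrite addn0 expr0 mul1r.
move=> QM; apply: IH.
have : xcolon (u + M.+1)%N v (x0 ^+ M.+1 * p).
  split=> //; exists N => a Na; rewrite /xshift addnS addSn ltnS leq0n subn1 /=.
  exists (x0 ^+ M * ('X_[a] * p)); last first.
    by rewrite expr1 mulrCA !mulrA -exprS.
  have := bimoduleX (U_(ord0) *+ M)%MM rees_bimodule (XQ a Na).
  by rewrite xE dE addnAC.
move=> /u1P; rewrite /xshift addnS ltnS leq0n subn1 /= => h.
have [|q Qq] := h; first by rewrite -addnS (leq_trans u1u) // leq_addr.
rewrite expr1 exprS -mulrA => /mulfI -> //.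
by rewrite -msupp_eq0 msuppX.
Qed.

End ReesAlgebra.

(** * Growth of the image coordinate ring *)

Section CommonPreimage.
Variables (k : fieldType) (V V' : lmodType k).

(** Each of the [m] conditions is the vanishing of a map into the cokernel of [B], so it costs at
    most h2 - rank B dimensions. *)
Lemma rank_common_kernel e h1 h2 m (B : 'M[k]_(h1, h2)) (M : 'I_m -> 'M[k]_(e,
  h2)) :
  exists2 K : 'M[k]_e, (forall i, K *m M i <= B)%MS &
    (e <= \rank K + m * (h2 - \rank B))%N.
Proof.
suff [K KP rK] : exists2 K : 'M[k]_e, forall i, i \in enum 'I_m -> (K *m M i <=
  B)%MS &
    (e <= \rank K + size (enum 'I_m) * (h2 - \rank B))%N.
  by exists K; [move=> i; apply: KP;
    rewrite mem_enum | rewrite size_enum_ord in rK].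
elim: (enum _) => [|i r [K KP rK]]; first by exists 1%:M;
  rewrite // mxrank1 addn0.
pose N := kermx (M i *m cokermx B); exists (K :&: N)%MS.
  move=> j; rewrite inE => /orP[/eqP -> | /KP]; last first.
    by apply: submx_trans; apply: submxMr; apply: capmxSl.
  by rewrite submxE -mulmxA; apply/eqP/sub_kermxP/capmxSr.
have := mxrank_sum_cap K N; have := rank_leq_col (K + N)%MS.
have : (\rank N >= e - (h2 - \rank B))%N.
  by rewrite mxrank_ker leq_sub2l // -mxrank_coker mxrankM_maxr.
rewrite /= mulSn; move: rK; move: (size r * _)%N => x.
move: (h2 - _)%N => y; move: (\rank N) => rN; move: (\rank (K :&: N)%MS) => rI.
by move: (\rank (K + N)%MS) (\rank K) => rS rk; lia.
Qed.

(** In coordinates, each condition that [phi i x] lie in [U] costs at most the codimension of [U] in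
    [W]. *)
Lemma common_preimage (E : V -> Prop) (U W : V' -> Prop) e h1 h2 m
    (phi : 'I_m -> V -> V') :
    has_dim E e -> has_dim U h1 -> has_dim W h2 -> (forall y, U y -> W y) ->
    (forall i, linear (phi i)) -> (forall i x, E x -> W (phi i x)) ->
    (m * (h2 - h1) < e)%N ->
  exists x, [/\ E x, x != 0 & forall i, U (phi i x)].
Proof.
move=> [b [Eb ib]] [u [Uu iu]] [w [Ww iw]] UW lin EW dim.
have /choice[B BE] i : exists c : 'rV[k]_h2, u i = \sum_j c 0 j *: w j.
  by apply/Ww/UW; apply: (has_dim_basis_in Uu).
have /choice[M ME] i : exists M : 'I_e -> 'rV[k]_h2,
    forall l, phi i (b l) = \sum_j M l 0 j *: w j.
  suff /choice[F FE] l : exists c : 'rV_h2, phi i (b l) = \sum_j c 0 j *: w j.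
    by exists F.
  by apply/Ww/EW; apply: (has_dim_basis_in Eb).
pose Bm : 'M[k]_(h1, h2) := \matrix_i B i.
pose Mm i : 'M[k]_(e, h2) := \matrix_l M i l.
have comb a (F : 'I_a -> 'rV[k]_h2) (c : 'rV[k]_a) :
    \sum_l c 0 l *: (\sum_j F l 0 j *: w j) =
    \sum_j (c *m \matrix_l F l) 0 j *: w j.
  under eq_bigr => l _ do rewrite scaler_sumr.
  rewrite exchange_big; apply: eq_bigr => j _ /=; rewrite !mxE scaler_suml.
  by apply: eq_bigr => l _; rewrite scalerA !mxE.
have uE (c : 'rV_h1) : \sum_i c 0 i *: u i = \sum_j (c *m Bm) 0 j *: w j.
  by rewrite -comb; apply: eq_bigr => i _; rewrite BE.
have rB : \rank Bm = h1.
  apply/eqP; rewrite -[_ == _]/(row_free Bm) -kermx_eq0;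
    apply/eqP/row_matrixP => i.
  rewrite row0; apply: iu; rewrite uE.
  have -> : row i (kermx Bm) *m Bm = 0 by rewrite -row_mul mulmx_ker row0.
  by rewrite big1 // => j _; rewrite mxE scale0r.
have [K KP rK] := rank_common_kernel Bm Mm.
have /rowV0Pn[c cK c0] : K != 0.
  by rewrite -mxrank_eq0 -lt0n; move: rK dim; rewrite rB; lia.
exists (\sum_i c 0 i *: b i); split.
- by apply/Eb; exists c.
- by apply: contra_neq c0; apply: ib.
move=> i; pose f : {linear V -> V'} :=
  HB.pack (phi i) (GRing.isLinear.Build _ _ _ _ (phi i) (lin i)).
have /submxP[a aE] : (c *m Mm i <= Bm)%MS.
  exact: submx_trans (submxMr _ cK) (KP i).
apply/Uu; exists a; rewrite uE -aE -comb -[phi i]/(f : V -> V') linear_sum.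
by apply: eq_bigr => l _; rewrite linearZ /= ME.
Qed.

Lemma has_dim_preim (phi : V -> V') (W : V -> Prop) (W' : V' -> Prop) h :
    linear phi -> (forall x, W x -> phi x = 0 -> x = 0) -> subspace W ->
    (forall y, W' y <-> exists2 x, W x & y = phi x) ->
  has_dim W' h -> has_dim W h.
Proof.
move=> lin inj sW WW' [b' [W'b ib']].
have /choice[b bP] i : exists x, W x /\ b' i = phi x.
  by have /WW'[x] := has_dim_basis_in W'b i; exists x.
pose f : {linear V -> V'} := HB.pack phi (GRing.isLinear.Build _ _ _ _ phi lin).
have fE (c : 'rV_h) : phi (\sum_i c 0 i *: b i) = \sum_i c 0 i *: b' i.
  rewrite -[phi]/(f : V -> V') linear_sum.
  by apply: eq_bigr => i _; rewrite linearZ /= (bP i).2.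
have Wsum (c : 'rV_h) : W (\sum_i c 0 i *: b i).
  by apply: subspace_sum => // i _; apply: subspaceZ => //; case: (bP i).
exists b; split=> [x|c c0]; last by apply: ib';
  rewrite -fE c0 (linear_for0 lin).
split=> [Wx|[c ->] //].
have /W'b[c xE] : W' (phi x) by apply/WW'; exists x.
exists c; apply/eqP; rewrite -subr_eq0; apply/eqP/inj; first exact: subspaceB.
by rewrite -[phi]/(f : V -> V') linearB /= -[X in _ - X]/(phi _) fE xE subrr.
Qed.

End CommonPreimage.

(** * Homogeneous forms and divisibility by powers of x0 *)

Section HomogeneousForms.
Variables (k : fieldType) (d : nat).
Local Notation R := {mpoly k[d.+1]}.

Lemma mpoly_homog_mons w (p : R) : p \is w.-homog ->
  p = \sum_(m <- mons d.+1 w) p@_m *: 'X_[m].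
Proof.
move=> hp; apply/mpolyP => m; rewrite raddf_sum /=.
have [/eqP mw|mw] := boolP (mdeg m == w).
  rewrite (bigD1_seq m) ?uniq_mons ?mem_mons ?mw //= mcoeffZ mcoeffX eqxx mulr1.
  rewrite big1 ?addr0 // => m' /negbTE ne.
  by rewrite mcoeffZ mcoeffX ne mulr0.
rewrite (dhomog_nemf_coeff hp mw) big_seq big1 // => m'.
rewrite mem_mons mcoeffZ mcoeffX => /eqP m'w.
by case: eqP => [m'm|]; [rewrite -m'w m'm eqxx in mw | rewrite mulr0].
Qed.

Lemma has_dim_homog w : has_dim (fun p : R => p \is w.-homog) 'C(w + d, d).
Proof.
rewrite -size_mons; set s := mons d.+1 w.
exists (fun i => 'X_[nth 0%MM s i]); split=> [p|c].
  split=> [hp|[c ->]]; last first.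
    apply: rpred_sum => i _; apply: rpredZ.
    by rewrite dhomogX -mem_mons mem_nth.
  exists (\row_i p@_(nth 0%MM s i)).
  rewrite {1}(mpoly_homog_mons hp) (big_nth 0%MM) big_mkord.
  by apply: eq_bigr => i _; rewrite mxE.
move=> c0; apply/rowP => i; rewrite mxE.
have := congr1 (mcoeff (nth 0%MM s i)) c0.
rewrite mcoeff0 raddf_sum (bigD1 i) //= mcoeffZ mcoeffX eqxx mulr1 big1 ?addr0
  //.
move=> j ji; rewrite mcoeffZ mcoeffX nth_uniq ?uniq_mons //.
by rewrite (inj_eq val_inj) (negbTE ji) mulr0.
Qed.

Lemma homog_mulXn_inv t w (g : R) :
  'X_ord0 ^+ t * g \is (t + w).-homog -> g \is w.-homog.
Proof.
rewrite mpolyXn => /dhomogP h; apply/dhomogP => m mg.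
have /h : (U_(ord0) *+ t + m)%MM \in msupp ('X_[U_(ord0) *+ t] * g).
  by rewrite mcoeff_msupp mulrC mcoeffMX -mcoeff_msupp.
by rewrite /= mdegD mdegMn mdeg1 mul1n => /addnI.
Qed.

Lemma msupp_mulXn t (q : R) m :
  m \in msupp ('X_ord0 ^+ t * q) -> (t <= m ord0)%N.
Proof.
rewrite mpolyXn => /msuppM_le/allpairsP[[a b] [/= /mem_msuppXP <- _ ->]].
by rewrite mnmDE mulmnE mnm1E eqxx mul1n leq_addr.
Qed.

Lemma mulXn_factor t (s : R) :
  (forall m, m \in msupp s -> (t <= m ord0)%N) -> exists g, s = 'X_ord0 ^+ t *
    g.
Proof.
move=> st; exists (\sum_(m <- msupp s) s@_m *: 'X_[m - U_(ord0) *+ t]).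
rewrite {1}[s]mpolyE mulr_sumr big_seq [RHS]big_seq; apply: eq_bigr => m /st tm.
rewrite -scalerAr mpolyXn -mpolyXD addmC submK //.
apply/mnm_lepP => i; rewrite mulmnE mnm1E.
by case: eqP => [<-|_]; rewrite ?mul1n.
Qed.

(* For d = 0 the hypothesis on the multiples is void and the degree is what makes
   s divisible. *)
Lemma mulXn_saturated t u w (s : R) : s \is w.-homog -> (t <= w)%N ->
    (forall a, mdeg a = u -> exists q, 'X_[a] * s = 'X_ord0 ^+ t * q) ->
  exists g, s = 'X_ord0 ^+ t * g.
Proof.
move=> /dhomogP hs tw sX; apply: mulXn_factor => m ms.
have [d0|d_gt0] := posnP d.
  rewrite (leq_trans tw) // -(hs m ms) /= mdegE big_ord_recl big1 ?addn0 // =>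
    i.
  by case: i => i ltid; exfalso; rewrite d0 in ltid.
(* For d > 0 the last variable differs from x0, so multiplying by its power leaves the exponent of
   x0 unchanged. *)
have [|q qE] := sX (U_(ord_max) *+ u)%MM; first by rewrite mdegMn mdeg1 mul1n.
have : (U_(ord_max) *+ u + m)%MM \in msupp ('X_ord0 ^+ t * q).
  by rewrite -qE mcoeff_msupp mulrC mcoeffMX -mcoeff_msupp.
move/msupp_mulXn; rewrite mnmDE mulmnE mnm1E -val_eqE /=.
by rewrite (gtn_eqF d_gt0).
Qed.

End HomogeneousForms.

(** * Dimension growth from generic finiteness *)

Section Growth.

(* Stated over an abstract field: in {fraction R} the same rewriting steps
   diverge during unification. *)
Let mulf_divK (F : fieldType) (x y a : F) : x != 0 -> x * y * (a / x) = a * y.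
Proof. by move=> x0; rewrite mulrC -mulrA mulKf. Qed.

Let mulf_ratio (F : fieldType) (x y a b : F) :
  x != 0 -> y * a * b = x * (y * (a / x * b)).
Proof. by move=> x0; rewrite mulrCA -[a / x * b]mulrA (mulrCA x) mulVKf //
  mulrA. Qed.
Let mulf_cancel (F : fieldType) (x y a : F) : x != 0 -> x * (y * (a / x)) = y *
  a.
Proof. by move=> x0; rewrite (mulrCA x y) (mulrCA x a) divff // mulr1. Qed.

Variables (k : fieldType) (d n : nat).
Local Notation R := {mpoly k[d.+1]}.
Variable f : n.+1.-tuple R.
Local Notation S := (image_coord_ring f).
Local Notation x0 := ('X_ord0 : R).

Lemma common_denominator (A_ : nat -> R -> Prop) (s : seq {fraction R}) :
    A_ 0%N 1 -> (forall w w' a b, A_ w a -> A_ w' b -> A_ (w + w')%N (a * b)) ->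
    (forall z, z \in s -> degree0_fractions A_ z) ->
  exists w D, [/\ A_ w D, D != 0 &
    forall z, z \in s -> exists2 a, A_ w a & z = tofrac a / tofrac D].
Proof.
move=> A1 AM; elim: s => [|z s IH] sA; first by exists 0%N, 1; rewrite oner_eq0.
have [z' z's|w [D [AD D0 DP]]] := IH; first by apply: sA; rewrite inE z's orbT.
have [w' [a [b [Aa Ab b0 zE]]]] := sA z (mem_head _ _).
exists (w' + w)%N, (b * D); split; [exact: AM | by rewrite mulf_neq0 |].
move=> z'; rewrite inE => /orP[/eqP ->|/DP[c Ac ->]].
  exists (a * D); first exact: AM.
  by rewrite zE !tofracM -mulf_div divff ?mulr1 ?tofrac_eq0.
exists (b * c); first exact: AM.
by rewrite !tofracM -mulf_div divff ?mul1r ?tofrac_eq0.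
Qed.

Lemma image_coord_ring1 : S 0%N 1.
Proof. by exists 1; [apply: dhomog1 | rewrite comp_mpoly1]. Qed.

Lemma image_coord_ringM w w' a b : S w a -> S w' b -> S (w + w')%N (a * b).
Proof.
move=> [g hg ->] [g' hg' ->]; exists (g * g'); first exact: dhomogM.
by rewrite rmorphM.
Qed.

Lemma image_coord_ring_subspace w : subspace (S w).
Proof.
split; first by exists 0; [apply: dhomog0 | rewrite comp_mpoly0].
move=> c _ _ [g hg ->] [g' hg' ->]; exists (c *: g + g').
  by apply: dhomogD => //; apply: dhomogZ.
by rewrite comp_mpolyD comp_mpolyZ.
Qed.

Lemma image_coord_ring_gen j : S 1%N (tnth f j).
Proof. by exists 'X_j;
  [rewrite dhomogX /= mdeg1 | rewrite comp_mpolyXU -tnth_nth]. Qed.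

Hypothesis f_neq0 : exists j, tnth f j != 0.
Hypothesis f_genfin : generically_finite f.

Lemma source_mul z z' : function_field_source z -> function_field_source z' ->
  @function_field_source k d (z * z').
Proof.
move=> [w [a [b [[_ ha] [_ hb] b0 ->]]]] [w' [a' [b' [[_ ha'] [_ hb'] b'0
  ->]]]].
exists (w + w')%N, (a * a'), (b * b'); split; last by rewrite !tofracM mulf_div.
- by split=> //; apply: dhomogM.
- by split=> //; apply: dhomogM.
by rewrite mulf_neq0.
Qed.

(* The multiplication table of K(P^d) over K(Y), cleared of denominators. *)
Lemma multiplication_table : exists r (b : 'I_r -> {fraction R}) w (D : R)
    (a : 'I_r -> R) (t : 'I_d.+1 -> 'I_r -> 'I_r -> R),
  [/\ (0 < w)%N, D != 0, (forall i, function_field_source (b i)),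
      (forall l, S w (a l)) /\ tofrac D = \sum_l tofrac (a l) * b l &
      (forall i l m, S w (t i l m)) /\
      forall i l, tofrac D * tofrac 'X_i * b l =
        tofrac x0 * \sum_m tofrac (t i l m) * b m].
Proof.
have x0_neq0 : x0 != 0 by rewrite -msupp_eq0 msuppX.
have [r [b [bS bP]]] := f_genfin.
have ratioS i : function_field_source (tofrac ('X_i : R) / tofrac x0).
  exists 1%N, ('X_i), x0; split=> //; split=> //; by rewrite dhomogX /= mdeg1.
have oneS : function_field_source (1 : {fraction R}).
  exists 0%N, 1, 1; rewrite oner_eq0 divr1 tofrac1; split=> //;
    by split=> //; apply: dhomog1.
(* Expressing 1 through the [b l] yields the expression for [D] from which iteration of the table
   starts. *)
have [c1 [c1S c1E]] := bP _ oneS.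
have /choice[c cP] (il : 'I_d.+1 * 'I_r) : exists c : 'I_r -> {fraction R},
    (forall m, function_field_image f (c m)) /\
    (tofrac 'X_il.1 / tofrac x0) * b il.2 = \sum_m c m * b m.
  by apply: bP; apply: source_mul.
pose s := codom c1 ++ codom (fun ilm : 'I_d.+1 * 'I_r * 'I_r => c ilm.1 ilm.2).
have [z|w [D [SD D0 DP]]] := @common_denominator S s image_coord_ring1
    image_coord_ringM.
  by rewrite mem_cat => /orP[/codomP[l ->]|/codomP[ilm ->]];
    [apply: c1S | exact: (cP ilm.1).1].
(* A nonzero f_j is multiplied into the denominator to make its degree positive. *)
have [j] := f_neq0; move: (tnth f j) (image_coord_ring_gen j) => fj Sfj fj0.
have DF0 : tofrac D != 0 by rewrite tofrac_eq0.
have x0F : tofrac x0 != 0 by rewrite tofrac_eq0.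
have fjF : tofrac fj != 0 by rewrite tofrac_eq0.
have DP' z : z \in s -> exists2 a, S w.+1 a &
    tofrac (D * fj) * z = tofrac a.
  move=> /DP[a Sa ->]; exists (a * fj).
    by rewrite -addn1; apply: image_coord_ringM.
  by rewrite tofracM tofracM; exact: (mulf_divK (tofrac fj) (tofrac a) DF0).
have /choice[a aP] l : exists a, S w.+1 a /\ tofrac (D * fj) * c1 l = tofrac a.
  have [|a Sa aE] := DP' (c1 l); first by rewrite mem_cat codom_f.
  by exists a.
have /choice[t tP] (ilm : 'I_d.+1 * 'I_r * 'I_r) : exists a, S w.+1 a /\
    tofrac (D * fj) * c ilm.1 ilm.2 = tofrac a.
  have [|e Se eE] := DP' (c ilm.1 ilm.2); last by exists e.
  by rewrite mem_cat; apply/orP; right; apply/codomP; exists ilm.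
exists r, b, w.+1, (D * fj), a, (fun i l m => t (i, l, m)); split=> //.
- by rewrite mulf_neq0.
- split=> [l|]; first exact: (aP l).1.
  rewrite -[LHS]mulr1 c1E mulr_sumr; apply: eq_bigr => l _.
  by rewrite mulrA (aP l).2.
split=> [i l m|i l]; first exact: (tP _).1.
have := (cP (i, l)).2 => /= e.
transitivity (tofrac x0 * (tofrac (D * fj) * (tofrac 'X_i / tofrac x0 * b l))).
  exact: (mulf_ratio (tofrac (D * fj)) (tofrac 'X_i) (b l) x0F).
rewrite e mulr_sumr; congr (_ * _); apply: eq_bigr => m _.
by rewrite mulrA (tP (i, l, m)).2.
Qed.

(** Applying the table once per variable of x^a gives D^(t+1) x^a as x0^t times an S-combination of
    the [b l]; a common denominator [h] of the [b l] then brings the relation back into the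
    polynomial ring. *)
Lemma homog_in_lattice : exists r w (D h : R) (g : 'I_r -> R),
  [/\ (0 < w)%N, D != 0, h != 0 & forall t a, mdeg a = t ->
    exists2 s : 'I_r -> R, forall l, S (t.+1 * w)%N (s l) &
      h * D ^+ t.+1 * 'X_[a] = x0 ^+ t * \sum_l s l * g l].
Proof.
have [r [b [w [D [a [t [w0 D0 bS [aS aE] [tS tE]]]]]]]] := multiplication_table.
pose H w (p : R) := graded_piece (fun=> True) w p.
have [||z|w' [h [_ h0 hP]]] := @common_denominator H (codom b).
- by split=> //; apply: dhomog1.
- by move=> u u' p q [_ hp] [_ hq]; split=> //; apply: dhomogM.
- by move=> /codomP[l ->]; apply: bS.
have /choice[g gP] l : exists g, b l = tofrac g / tofrac h.
  by have [g _ gE] := hP _ (codom_f b l); exists g.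
have hF : tofrac h != 0 by rewrite tofrac_eq0.
exists r, w, D, h, g; split=> //.
suff E u al : mdeg al = u -> exists2 s : 'I_r -> R,
    forall l, S (u.+1 * w)%N (s l) &
    tofrac D ^+ u.+1 * tofrac 'X_[al] = tofrac x0 ^+ u * \sum_l tofrac (s l) *
      b l.
  move=> u al /E[s sS sE]; exists s => //; apply/eqP; rewrite -tofrac_eq;
    apply/eqP.
  rewrite !tofracM !tofracXn -mulrA sE mulrCA; congr (_ * _).
  rewrite mulr_sumr raddf_sum; apply: eq_bigr => l _ /=.
  by rewrite tofracM gP; exact: (mulf_cancel (tofrac (s l)) (tofrac (g l)) hF).
elim/mdeg_ind: u al / => [|u i al _ [s sS sE]].
  exists a => [l|]; first by rewrite mul1n.
  by rewrite mpolyX0 tofrac1 mulr1 expr1 mul1r.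
exists (fun m => \sum_l s l * t i l m) => [m|].
  apply: subspace_sum => [|l _]; first exact: image_coord_ring_subspace.
  by rewrite [(u.+2 * w)%N]mulSn addnC; apply: image_coord_ringM.
rewrite mpolyXD tofracM exprS mulrACA sE mulrCA exprSr -[RHS]mulrA;
  congr (_ * _).
transitivity (\sum_l tofrac (s l) * (tofrac x0 * \sum_m tofrac (t i l m) * b
  m)).
  by rewrite mulr_sumr; apply: eq_bigr => l _; rewrite -tE mulrCA.
transitivity (tofrac x0 * \sum_l \sum_m tofrac (s l) * (tofrac (t i l m) * b
  m)).
  rewrite [RHS]mulr_sumr; apply: eq_bigr => l _.
  by rewrite mulrCA; congr (_ * _); rewrite mulr_sumr.
congr (_ * _); rewrite exchange_big; apply: eq_bigr => m _ /=.
rewrite raddf_sum mulr_suml; apply: eq_bigr => l _.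
by rewrite mulrA -tofracM.
Qed.

Variable delta : nat.
Hypothesis f_homog : forall j, tnth f j \is delta.-homog.
Local Notation Q := (rees_piece f delta).

Lemma image_coord_ring_rees w a : S w a -> Q 0 w a.
Proof.
move=> [g /dhomogP hg ->]; rewrite comp_mpolyEX; apply: subspace_sum_seq.
  exact: rees_subspace.
move=> m /hg mw; apply: subspaceZ; first exact: rees_subspace.
have := beval_in_rees f_homog (x := (0%MM, m)) mdeg0 mw.
by rewrite /beval mpolyX0 mul1r.
Qed.

(** Multiplication by a fixed nonzero form embeds R_t into the sum of the [r] spaces x0^t g_l Q_(0,
    (t+1) w). *)
Lemma rees0_growth : exists w r, (0 < w)%N /\
  forall t h, has_dim (Q 0 (t.+1 * w)) h -> ('C(t + d, d) <= h * r)%N.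
Proof.
have [r [w [D [c [g [w0 D0 c0 latt]]]]]] := homog_in_lattice.
exists w, r; split=> // t h /has_dim_seq[e <- eP].
rewrite -[r]card_ord cardE -(size_allpairs (fun q l => x0 ^+ t * (q * g l))).
have lin : linear (fun p => c * D ^+ t.+1 * p) by apply: mulr_linear.
apply: (has_dim_inj_le_size lin _ (has_dim_homog k d t)).
  by apply: mulr_eq0_inj; rewrite mulf_neq0 ?expf_neq0.
set T := lspan _; have sT : subspace T by apply: lspan_subspace.
move=> p hp; rewrite (mpoly_homog_mons hp) mulr_sumr.
apply: subspace_sum_seq => // m; rewrite mem_mons => /eqP mt.
rewrite -scalerAr; apply: subspaceZ => //; have [s sS ->] := latt t m mt.
rewrite mulr_sumr; apply: subspace_sum => // l _.
have := sS l => /image_coord_ring_rees/eP; move: (s l).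
apply: (lspan_linear (phi := fun q => x0 ^+ t * (q * g l))) => //.
  by move=> a p1 p2; rewrite mulrDl mulrDr -scalerAl -scalerAr.
move=> q qe; apply: lspan_in; apply/allpairsP.
by exists (q, l); rewrite mem_enum.
Qed.

Lemma rees0_not_small (q : {poly rat}) N : (size q <= d)%N ->
  exists2 v, (N <= v)%N & forall h, has_dim (Q 0 v) h -> q.[v%:R] < h%:R.
Proof.
move=> sq; have [w [r [w0 growth]]] := rees0_growth.
apply: contrapT => small.
have {}small v : (N <= v)%N -> exists2 h, has_dim (Q 0 v) h & h%:R <= q.[v%:R].
  move=> Nv; apply: contrapT => H; apply: small; exists v => // h dh.
  by rewrite ltNge; apply/negP => le; apply: H; exists h.
pose lin : {poly rat} := w%:R%:P * ('X + 1%:P).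
pose q2 := r%:R%:P * (q \Po lin).
have sq2 : (size q2 <= d)%N.
  have [q0|q0] := eqVneq q 0;
    first by rewrite /q2 q0 comp_poly0 mulr0 size_poly0.
  rewrite /q2 mul_polyC (leq_trans (size_scale_leq _ _)) //.
  apply: leq_trans (size_comp_poly_leq _ _) _.
  have slin : (size lin <= 2)%N.
    by rewrite /lin mul_polyC (leq_trans (size_scale_leq _ _)) // size_XaddC.
  have : (0 < size q)%N by rewrite lt0n size_poly_eq0.
  case: (size q) sq => // m md _ /=; apply: leq_trans md.
  by rewrite ltnS -[leqRHS]muln1 leq_mul2l;
    case: (size lin) slin => [|[|[]]] //; rewrite ?orbT.
suff : (size (binpoly d) <= size q2)%N by rewrite size_binpoly ltnNge sq2.
apply: (@poly_le_size _ _ N) => t Nt; rewrite horner_binpoly ler0n /=.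
have [|h dh hq] := small (t.+1 * w)%N; first by nia.
have := growth t h dh; rewrite -(ler_nat rat) => /le_trans; apply.
rewrite hornerM hornerC horner_comp /lin hornerM hornerD hornerX !hornerC.
rewrite natr1 -natrM [(w * _)%N]mulnC natrM mulrC.
by apply: ler_wpM2l; rewrite ?ler0n // -natrM.
Qed.

End Growth.

(** * Comparison of the Hilbert polynomials *)

Section ProjectiveDegree.
Variables (k : fieldType) (d n delta : nat).
Local Notation R := {mpoly k[d.+1]}.
Variable f : n.+1.-tuple R.
Hypothesis delta_gt0 : (0 < delta)%N.
Hypothesis f_homog : forall j, tnth f j \is delta.-homog.
Hypothesis f_neq0 : exists j, tnth f j != 0.
Hypothesis f_genfin : generically_finite f.
Local Notation Q := (rees_piece f delta).
Local Notation x0 := ('X_ord0 : R).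

Let x0_neq0 t : x0 ^+ t != 0.
Proof. by rewrite expf_neq0 // -msupp_eq0 msuppX. Qed.

Variables (h : nat -> nat -> nat) (P : {poly {poly rat}}) (N : nat).
Hypothesis hQ : forall u v, has_dim (Q u v) (h u v).
Hypothesis hP : forall u v, (N <= u)%N -> (N <= v)%N ->
  (h u v)%:R = P.[u%:R, v%:R].

Lemma dim_rees_le u v : (h u v <= 'C(u + v * delta + d, d))%N.
Proof.
by apply: (has_dim_inj_le (phi := idfun) _ _ (hQ u v)
  (has_dim_homog k d (u + v * delta))) => // p [].
Qed.

Lemma dim_rees_mono u t v : (h u v <= h (u + t) v)%N.
Proof.
apply: (has_dim_inj_le (mulr_linear (x0 ^+ t)) _ (hQ u v) (hQ (u + t)%N v)).
  exact: mulr_eq0_inj.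
move=> p pQ; rewrite mpolyXn.
have := bimoduleX (U_(ord0) *+ t)%MM (rees_bimodule f_homog) pQ.
by rewrite mdegMn mdeg1 mul1n.
Qed.

Local Notation P_ u := (P.[u%:R%:P]).

(** The dimension of R in degree u + v delta as a polynomial in [v]; its coefficient of v^d is
    independent of [u]. *)
Let bound u : {poly rat} := binpoly d \Po (delta%:R%:P * 'X + u%:R%:P).

Let size_lin (u : nat) : size (delta%:R%:P * 'X + u%:R%:P : {poly rat}) = 2%N.
Proof. by rewrite size_MXaddC size_polyC polyC_eq0 pnatr_eq0 eqn0Ngt delta_gt0.
  Qed.

Let size_bound u : size (bound u) = d.+1.
Proof.
have := size_comp_poly (binpoly d) (delta%:R%:P * 'X + u%:R%:P).
rewrite size_lin size_binpoly muln1 /= -/(bound u) => e.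
(* The equation [e] concerns predecessors of sizes, which do not separate sizes 0 and 1, so for d =
   0 the vanishing of [bound u] has to be excluded. *)
have [b0|b0] := eqVneq (size (bound u)) 0; last by rewrite -e prednK // lt0n.
have : lead_coef (bound u) != 0.
  rewrite lead_coef_comp ?size_lin // mulf_neq0 ?expf_neq0 //.
    by rewrite gt_eqF // lead_coef_binpoly_gt0.
  by rewrite lead_coef_eq0 -size_poly_eq0 size_lin.
by rewrite lead_coef_eq0 -size_poly_eq0 b0.
Qed.

Let bound_coef u : (bound u)`_d = lead_coef (binpoly d) * delta%:R ^+ d.
Proof.
have -> : (bound u)`_d = lead_coef (bound u) by rewrite lead_coefE size_bound.
rewrite lead_coef_comp ?size_lin // size_binpoly lead_coefDl ?lead_coefMX
  ?lead_coefC //.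
rewrite size_mulX ?size_polyC ?polyC_eq0 ?pnatr_eq0 ?eqn0Ngt ?delta_gt0 //.
by rewrite (leq_ltn_trans (leq_b1 _)).
Qed.

Let P_bounds u v : (N <= u)%N -> (N <= v)%N ->
  0 <= (P_ u).[v%:R] <= (bound u).[v%:R].
Proof.
move=> Nu Nv; rewrite -hP // ler0n /= horner_comp hornerD hornerMX !hornerC.
rewrite -natrM -natrD horner_binpoly ler_nat addnC [(delta * v)%N]mulnC.
by rewrite addnC [(v * delta + u)%N]addnC dim_rees_le.
Qed.

Lemma size_rees_poly u : (N <= u)%N -> (size (P_ u) <= d.+1)%N.
Proof.
by move=> Nu; rewrite -(size_bound u); apply: (@poly_le_size _ _ N) => v;
  apply: P_bounds.
Qed.

Let coef_ge0 u : (N <= u)%N -> 0 <= (P_ u)`_d.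
Proof.
move=> Nu; have := @poly_le_coef 0 (P_ u) d N; rewrite size_poly0 coef0.
apply=> //; first exact: size_rees_poly.
by move=> v /(P_bounds Nu)/andP[]; rewrite horner0.
Qed.

(* The coefficient of v^d is a polynomial in u; it is bounded, since
   dim Q_(u, v) <= dim R_(u + v delta), hence constant. *)
Lemma coef_rees_poly u : (N <= u)%N -> (P_ u)`_d = P`_0`_d.
Proof.
pose c := \poly_(i < size P) P`_i`_d.
have cE w : (P_ w)`_d = c.[w%:R].
  rewrite horner_coef coef_sum horner_poly; apply: eq_bigr => i _.
  by rewrite -rmorphXn coefMC.
have sc : (size c <= size (lead_coef (binpoly d) * delta%:R ^+ d)%:P)%N.
  apply: (@poly_le_size _ _ N) => v Nv; rewrite -cE hornerC -(bound_coef v).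
  apply/andP; split; last first.
    apply: (@poly_le_coef _ _ d N (size_rees_poly Nv));
      first by rewrite size_bound.
    by move=> w /(P_bounds Nv)/andP[].
  exact: coef_ge0.
have /size1_polyC cC : (size c <= 1)%N by rewrite (leq_trans sc) // size_polyC
  leq_b1.
move=> _; rewrite cE cC hornerC coef_poly; case: ifP => // /negbT.
by rewrite -leqNgt => /(nth_default 0) ->; rewrite coef0.
Qed.

Let h0_le u v : (h 0 v <= h u v)%N.
Proof. by rewrite -[u]add0n dim_rees_mono. Qed.

(** Otherwise [P_ N] would have degree below [d] while bounding dim Q_(0,v), because x0^N embeds
    Q_(0,v) in Q_(N,v). *)
Lemma coef_rees_poly_gt0 : 0 < P`_0`_d.
Proof.
have P0 : 0 <= P`_0`_d.
  by rewrite -(coef_rees_poly (leqnn N)) coef_ge0.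
rewrite lt_neqAle P0 andbT eq_sym; apply/negP => /eqP P00.
have [|v Nv] := @rees0_not_small _ _ _ _ f_neq0 f_genfin _ f_homog (P_ N) N.
  by rewrite leqNgt; apply/negP => sP; have := size_rees_poly (leqnn N);
    rewrite leq_eqVlt ltnS leqNgt sP orbF => /eqP sN;
    have := lead_coefE (P_ N); rewrite sN /= coef_rees_poly // P00 => /eqP;
    rewrite lead_coef_eq0 -size_poly_eq0 sN.
by move=> /(_ _ (hQ 0 v)); rewrite -hP // ltr_nat ltnNge h0_le.
Qed.

Lemma size_rees_polyE u : (N <= u)%N -> size (P_ u) = d.+1.
Proof.
move=> Nu; apply/eqP; rewrite eqn_leq size_rees_poly //= ltnNge.
apply: contraL coef_rees_poly_gt0 => sP.
by rewrite -(coef_rees_poly Nu) nth_default // ltxx.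
Qed.

(* Kodaira's lemma: O(0, c) minus t times the pulled back hyperplane class is
   effective for some c, because the conditions on a form in S_c grow like
   c^(d - 1). *)
Lemma sat_divisible t : (N <= t)%N -> exists c g,
  [/\ g != 0, (t <= c * delta)%N, g \is (c * delta - t).-homog &
      forall a, mdeg a = (t + t)%N -> ideal_exp (base_ideal f) c ('X_[a] * g)].
Proof.
(* With x-degree 2t, dividing by x0^t still leaves x-degree t >= N, where [P_ t] computes
   dimensions. *)
move=> Nt; set u := (t + t)%N; pose s := mons d.+1 u.
have Nu : (N <= u)%N by rewrite (leq_trans Nt) // leq_addr.
(* The cost of forcing all x^a p with |a| = u into x0^t Q_(t,c); the coefficients of v^d cancel, so
   it has degree below [d]. *)
pose q := (size s)%:R%:P * (P_ u - P_ t).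
have sq : (size q <= d)%N.
  rewrite /q mul_polyC (leq_trans (size_scale_leq _ _)) //.
  apply/leq_sizeP => j; rewrite leq_eqVlt => /orP[/eqP <-|dj].
    by rewrite coefB !coef_rees_poly // subrr.
  by rewrite coefB !nth_default ?subrr // size_rees_polyE.
have [c Nc cP] := @rees0_not_small _ _ _ _ f_neq0 f_genfin _ f_homog q (N + t)
  sq.
have Nc' : (N <= c)%N by rewrite (leq_trans _ Nc) // leq_addr.
(* The bound c >= N + t keeps c delta - t from truncating. *)
have tc : (t <= c * delta)%N.
  by rewrite (leq_trans _ (leq_pmulr c delta_gt0)) // (leq_trans _ Nc) //
    leq_addl.
have dimU : has_dim (xshift t Q u c) (h t c).
  apply: (has_dim_inj (mulr_linear (x0 ^+ t)) _ _ (hQ t c));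
    first exact: mulr_eq0_inj.
  by move=> p; rewrite /xshift leq_addr addnK.
have [] := @common_preimage _ _ _ _ _ _ _ _ _ (size s)
    (fun i p => 'X_[nth 0%MM s i] * p) (hQ 0 c) dimU (hQ u c).
- by move=> p; rewrite /xshift leq_addr addnK => -[p' p'Q ->];
    rewrite mpolyXn; have := bimoduleX (U_(ord0) *+ t)%MM (rees_bimodule
      f_homog) p'Q;
    rewrite mdegMn mdeg1 mul1n.
- by move=> i; apply: mulr_linear.
- move=> i p pQ; have := bimoduleX (nth 0%MM s i) (rees_bimodule f_homog) pQ.
  suff -> : mdeg (nth 0%MM s i) = u by [].
  by apply/eqP; rewrite -mem_mons mem_nth.
- rewrite -(ltr_nat rat) natrM natrB; last exact: dim_rees_mono.
  by have := cP _ (hQ 0 c); rewrite /q hornerM hornerC hornerD hornerN -!hP.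
move=> p [[_ hp] p0 pU].
have {}pU a : mdeg a = u -> exists2 p', Q t c p' & 'X_[a] * p = x0 ^+ t * p'.
  move=> au; have ias : (index a s < size s)%N by rewrite index_mem mem_mons au.
  have := pU (Ordinal ias); rewrite /xshift leq_addr addnK /= nth_index //.
  by rewrite mem_mons au.
have [||g pE] := @mulXn_saturated _ _ t u (0 + c * delta) p hp.
- by rewrite add0n.
- by move=> a /pU[p' _ ->]; exists p'.
exists c, g; split=> //.
- by apply: contraNneq p0 => g0; rewrite pE g0 mulr0.
- by apply: (@homog_mulXn_inv _ _ t); rewrite -pE subnKC.
move=> a /pU[p' [p'I _]]; rewrite pE mulrCA => /mulfI -> //.
Qed.

Local Notation A := (sat_fiber_piece f delta).

(** Multiplication by the form [g] of [sat_divisible] sends Q_(t,v) into A_(c+v): its degree makes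
    up for the x-degree [t], and monomials of degree 2t carry [g] into I^c. *)
Lemma sat_fiber_ge t : (N <= t)%N -> exists c, forall v a,
  has_dim (A (c + v)) a -> (h t v <= a)%N.
Proof.
move=> /sat_divisible[c [g [g0 tc hg gI]]]; exists c => v a da.
apply: (has_dim_inj_le (mulr_linear g) _ (hQ t v) da);
  first exact: mulr_eq0_inj.
move=> p [pI hp]; split; last first.
  have -> : ((c + v) * delta = c * delta - t + (t + v * delta))%N.
    by rewrite addnA subnK // mulnDl.
  exact: dhomogM.
apply/ideal_sat_irrelevantP; exists (t + t)%N => al /mnm_le_mdeg[b bu ba].
rewrite -(submK ba) mpolyXD -mulrA; apply: ideal_expM; rewrite mulrA.
by apply: ideal_exp_mul => //; apply: gI.
Qed.

(** The shift by x0^u1 moves the saturation into [Q], where dimensions are eventually polynomial;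
    the fixed row u = u1 is a copy of [A], handled by the second clause of [evpoly]. *)
Lemma sat_fiber_hilbert : exists2 u1, (N <= u1)%N &
  exists2 a : nat -> nat, (forall v, has_dim (A v) (a v)) &
    (forall v, (a v <= h u1 v)%N) /\
    exists (p : {poly rat}) (M : nat), forall v, (M <= v)%N -> (a v)%:R =
      p.[v%:R].
Proof.
have [u2 u2P] := sat_large f_homog; pose u1 := maxn N u2.
pose W := xshift u1 (sat_piece delta f).
have mW : bimodule f W by apply/xshift_bimodule/sat_bimodule.
have WQ u v p : W u v p -> Q u v p.
  rewrite /W /xshift; case: ifP => [u1u [q qS ->]|_ ->]; last first.
    by case: (rees_subspace delta f u v).
  apply: u2P; first by rewrite (leq_trans (leq_maxr N u2)).
  have := bimoduleX (U_(ord0) *+ u1)%MM (sat_bimodule f_homog) qS.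
  by rewrite mdegMn mdeg1 mul1n mpolyXn subnK.
have [a aW [_ [M aM]]] := has_dim_evpoly f_homog mW WQ.
exists u1; first exact: leq_maxl.
have sA v : subspace (A v).
  by have [sS _] := sat_bimodule f_homog; apply: (sS 0%N v).
exists (a u1) => [v|].
  apply: (has_dim_preim (mulr_linear (x0 ^+ u1)) _ (sA v) _ (aW u1 v)).
    exact: mulr_eq0_inj.
  by move=> p; rewrite /W /xshift leqnn subnn.
split=> [v|]; last by have [p pE] := aM u1; exists p, M.
by apply: (has_dim_inj_le (phi := idfun) _ _ (aW u1 v) (hQ u1 v)) => // p;
  apply: WQ.
Qed.

(** Squeeze: [p] is at most [P_ u1], and its translate by [c] is at least [P_ N]. Translation
    changes neither degree nor leading coefficient, and both bounds have degree [d] and the same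
    coefficient of v^d. *)
Lemma multiplicity_sat_fiber :
  is_multiplicity A (d`!%:R * P`_0`_d).
Proof.
have [u1 Nu1 [a aA [a_le [p [M pE]]]]] := sat_fiber_hilbert.
have [c cP] := sat_fiber_ge (leqnn N).
have sp_le : (size p <= d.+1)%N.
  rewrite -(size_rees_polyE Nu1); apply: (@poly_le_size _ _ (maxn N M)) => v.
  by rewrite geq_max => /andP[Nv Mv]; rewrite -pE // -hP // ler0n ler_nat a_le.
pose p' := p \Po ('X + c%:R%:P).
have p'E v : p'.[v%:R] = p.[(c + v)%N%:R].
  by rewrite horner_comp hornerD hornerX hornerC -natrD addnC.
have sp' : size p' = size p by rewrite size_comp_poly2 // size_XaddC.
have P_le_p' v : (maxn N M <= v)%N -> 0 <= (P_ N).[v%:R] <= p'.[v%:R].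
  rewrite geq_max => /andP[Nv Mv]; rewrite -hP // ler0n p'E -pE.
    by rewrite ler_nat (cP _ _ (aA _)).
  by rewrite (leq_trans Mv) // leq_addl.
have sp : size p = d.+1.
  apply/eqP; rewrite eqn_leq sp_le -sp' -(size_rees_polyE (leqnn N)).
  exact: poly_le_size P_le_p'.
exists p; first by exists M => v Mv; exists (a v); rewrite ?pE.
rewrite sp /=; congr (_ * _); apply/eqP; rewrite eq_le; apply/andP; split.
  have -> : lead_coef p = p'`_d.
    have -> : p'`_d = lead_coef p' by rewrite lead_coefE sp' sp.
    by rewrite lead_coef_comp ?size_XaddC // lead_coefXaddC expr1n mulr1.
  rewrite -(coef_rees_poly (leqnn N)).
  apply: (@poly_le_coef _ _ d (maxn N M)); rewrite ?size_rees_polyE ?sp' ?sp //.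
  by move=> v /P_le_p'/andP[].
rewrite lead_coefE sp -(coef_rees_poly Nu1).
apply: (@poly_le_coef _ _ d (maxn N M)); rewrite ?size_rees_polyE ?sp //.
move=> v; rewrite geq_max => /andP[Nv Mv].
by rewrite -pE // -hP // ler_nat a_le.
Qed.

End ProjectiveDegree.

Theorem theorem5p4 (k : fieldType) (d n delta : nat)
    (f : n.+1.-tuple {mpoly k[d.+1]})
    (le_dn : (d <= n)%N)
    (delta_gt0 : (0 < delta)%N)
    (f_homog : forall j : 'I_n.+1, tnth f j \is delta.-homog)
    (f_neq0 : exists j : 'I_n.+1, tnth f j != 0)
    (f_genfin : generically_finite f) :
  exists e : rat,
    is_projective_degree f delta 0 e /\
    is_multiplicity (sat_fiber_piece f delta) e.
Proof.
have [h hQ [[P [N hP]] _]] :=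
  has_dim_evpoly f_homog (rees_bimodule f_homog) (fun _ _ _ pQ => pQ).
(* The normalization 0! d! of the coefficient of u^0 v^d agrees with the factor (s - 1)! = d! of the
   multiplicity. *)
exists (d`!%:R * P`_0`_d); split.
  exists P; last by rewrite fact0 mul1n subn0.
  by exists N => u v Nu Nv; exists (h u v); rewrite ?hP.
exact: (multiplicity_sat_fiber delta_gt0 f_homog f_neq0 f_genfin hQ hP).
Qed.
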